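(* For every constant $\alpha>0$ there exists a constant $C>0$ such that every $(n,d,\lambda)$-graph with $d\ge n^{\alpha}$ and $d/\lambda\ge C$ contains a Hamilton cycle.
   Context: An $(n,d,\lambda)$-graph is an $n$-vertex $d$-regular graph whose second largest eigenvalue in absolute value (of its adjacency matrix) is at most $\lambda$. *)

(* Defs.v *)
From HB Require Import structures.
From mathcomp Require Import all_boot all_order all_algebra.
From mathcomp Require Import reals exp.
Set Implicit Arguments. Unset Strict Implicit. Unset Printing Implicit Defensive.
Import Order.TTheory GRing.Theory Num.Theory.
Local Open Scope ring_scope.

Definition simple_graph (n : nat) (e : rel 'I_n) : Prop :=
  symmetric e /\ irreflexive e.

Definition regular (n : nat) (e : rel 'I_n) (d : nat) : Prop :=
  forall i : 'I_n, #|[set j | e i j]| = d.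

Definition adjmx (R : realType) (n : nat) (e : rel 'I_n) : 'M[R]_n :=
  \matrix_(i, j) (e i j)%:R.

(* The eigenvalues (roots of the characteristic polynomial, with
   multiplicity) of the adjacency matrix are d together with the entries of
   a list s, all of absolute value at most lam; i.e. the second largest
   eigenvalue in absolute value is at most lam. *)
Definition second_eig_le (R : realType) (n : nat) (e : rel 'I_n) (d : nat)
    (lam : R) : Prop :=
  exists s : seq R,
    char_poly (adjmx R e) = ('X - (d%:R)%:P) * \prod_(mu <- s) ('X - mu%:P)
    /\ all (fun mu => `|mu| <= lam) s.

Definition ndl_graph (R : realType) (n : nat) (e : rel 'I_n) (d : nat)
    (lam : R) : Prop :=
  [/\ simple_graph e, regular e d & @second_eig_le R n e d lam].

Definition hamiltonian (n : nat) (e : rel 'I_n) : Prop :=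
  exists s : seq 'I_n, [/\ 3 <= size s, size s = n, uniq s & cycle e s]%N.

(* Main.v *)
(* By the expander mixing lemma, the graph expands well between linear-sized sets.

   Random sets inherit expansion. Every nonempty set S has a fingerprint: a subset U, obtained
   greedily, such that |N(U)| >= q |U| and every vertex of S has fewer than q neighbours
   outside N(U). Hence only the sets N(U) and core(U) = {x : |N(x) - N(U)| < q} have to be
   controlled, and as |N(U)| >= q |U| with q polylogarithmic, Chernoff bounds and a union bound
   over U show that random layers of size n / polylog(n) do it. Hall's theorem then gives a
   perfect matching between any two layers, and so K disjoint paths through a given sequence
   of layers of common size K, covering them.

   In a reserved part P of the graph, Friedman-Pippenger extendability yields K disjoint switch
   gadgets: ladders that can join either of two vertices a, b to a third vertex c through all
   rungs, leaving the other one to a second strand. Once the remaining vertices are covered by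
   K paths through layers, every choice of switch positions gives a 2-factor, and flipping a
   switch multiplies its successor permutation by a transposition. A switch whose two strands
   lie in different cycles could be flipped to merge them, so in a 2-factor with the fewest
   cycles the two strands of each switch lie together; as the gadgets are linked in a cyclic
   order, this 2-factor is a Hamilton cycle. *)
Require Import Defs.
From HB Require Import structures.
From mathcomp Require Import all_boot all_order all_algebra.
From mathcomp Require Import fingroup perm.
From mathcomp Require Import complex spectral.
From mathcomp Require Import reals exp.
From mathcomp Require Import ring lra zify.
Set Implicit Arguments. Unset Strict Implicit. Unset Printing Implicit Defensive.

(** * Merging cycles by switches *)

(** Since d / lambda is only a constant, a set S is only guaranteed a neighbourhood larger by a
    constant factor. That is too little for a union bound over all S: a layer of density 1 /
    polylog(n) misses its share of N(S) with probability exp(-|N(S)| / polylog(n)), against about n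
    ^ |S| sets. Fingerprints restore the balance, and their price 2 g q <= d is where d >= n ^ alpha
    enters: d has to beat a fixed power of log n.

    The vertex count must be exact. All links have the same length, so the gadgets use a number of
    vertices known in advance; a path with n mod (l + 1) vertices is inserted into one connection,
    and what remains has size a multiple of K. This remainder is known only after the gadgets, hence
    two random cuts: one gives the end layers A, I and the reserve P, leaving a share of every N(U)
    outside; the other cuts what the gadgets leave. That the final cycle repeats no vertex follows
    by counting.

    The constant C does double duty: the adjacency matrix has trace zero, which forces n > d /
    lambda, so a large C also excludes small n. *)

Section Merging.
Variables (k : nat) (nxt : {perm 'I_k.+1 * bool}).

Definition flip_perm (j : 'I_k.+1) : {perm 'I_k.+1 * bool} :=
  tperm (j, false) (j, true).

(** The pair [(j, b)] stands for entrance [b] of gadget [j] and also for its exit [b]. Position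
    [s j] leads entrance [b] to exit [b (+) s j], and [nxt] tells which entrance follows an exit. *)
Definition state_fun (s : {ffun 'I_k.+1 -> bool}) (x : 'I_k.+1 * bool) :=
  (x.1, x.2 (+) s x.1).

Lemma state_fun_inj (s : {ffun 'I_k.+1 -> bool}) : injective (state_fun s).
Proof. by move=> [i b] [j c] [-> /=] /addIb ->. Qed.

Definition state_perm (s : {ffun 'I_k.+1 -> bool}) := (perm (@state_fun_inj s) * nxt)%g.

Lemma state_permE s x : state_perm s x = nxt (x.1, x.2 (+) s x.1).
Proof. by rewrite permM permE. Qed.

Lemma state_perm_flip (s : {ffun 'I_k.+1 -> bool}) j :
  state_perm [ffun i : 'I_k.+1 => s i (+) (i == j)] = (flip_perm j * state_perm s)%g.
Proof.
apply/permP=> -[i b]; rewrite [RHS]permM !state_permE ffunE /flip_perm.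
have [->|ij] := eqVneq i j.
  by case: b; rewrite ?tpermL ?tpermR /=; case: (s j).
by rewrite tpermD /= ?addbF // xpair_eqE eq_sym (negbTE ij).
Qed.

(* Among all switch positions take one with the fewest orbits: toggling a gadget
   whose two strands lie in different orbits would merge them. *)
Lemma exists_single_orbit :
  (forall j : 'I_k.+1, nxt (j, false) = (inord (j.+1 %% k.+1), false)) ->
  exists s : {ffun 'I_k.+1 -> bool}, forall x y, x \in porbit (state_perm s) y.
Proof.
move=> chain.
pose s := [arg min_(s < [ffun=> false] : {ffun 'I_k.+1 -> bool})
             #|porbits (state_perm s)|].
have smin t : #|porbits (state_perm s)| <= #|porbits (state_perm t)|.
  by rewrite /s; case: arg_minnP => // s0 _ /(_ t isT).
have both j : (j, true) \in porbit (state_perm s) (j, false).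
  apply: contraT => nin.
  have := smin [ffun i : 'I_k.+1 => s i (+) (i == j)].
  rewrite state_perm_flip /flip_perm.
  have /= := porbits_mul_tperm (state_perm s) (j, false) (j, true).
  rewrite porbit_sym nin xpair_eqE andbF /=.
  by move: #|porbits (state_perm s)| #|porbits (_ * _)%g| => a b; rewrite addn1 addn2 => -[<-]; rewrite ltnn.
(* Whatever [s i] is, the strand [(i, s i)] is sent to [nxt (i, false)], the [false] strand of the
   next gadget. As both strands of [i] share an orbit, the orbit of [(ord0, false)] spreads along
   the chain. Beyond [k], the default value of [inord] is [ord0] itself. *)
have all0 j : (inord j, false) \in porbit (state_perm s) (ord0, false).
  elim: j => [|j IHj]; first by rewrite (_ : inord 0 = ord0) ?porbit_id //; apply/val_inj; rewrite /= inordK.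
  have [jk|jk] := ltnP j.+1 k.+1; last first.
    by rewrite (_ : inord _ = ord0) ?porbit_id //; rewrite /inord /insubd insubN // -leqNgt.
  pose i : 'I_k.+1 := inord j.
  have vi : i = j :> nat by rewrite inordK // ltnW.
  have ->: (inord j.+1, false) = state_perm s (i, s i).
    by rewrite state_permE /= addbb chain vi modn_small.
  have -> : state_perm s (i, s i) = ((state_perm s) ^+ 1)%g (i, s i) by rewrite expg1.
  rewrite -eq_porbit_mem porbit_perm eq_porbit_mem.
  rewrite -eq_porbit_mem; move: IHj; rewrite -/i -eq_porbit_mem => /eqP <-.
  by rewrite eq_porbit_mem; case: (s i); rewrite ?both ?porbit_id.
have allx x : x \in porbit (state_perm s) (ord0, false).
  case: x => j b; rewrite -[j]inord_val; have := all0 j.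
  rewrite -!eq_porbit_mem => /eqP <-; rewrite eq_porbit_mem.
  by case: b; rewrite ?both ?porbit_id.
exists s => x y; have := allx x; have := allx y.
by rewrite -!eq_porbit_mem => /eqP <-.
Qed.

End Merging.

(** * Hall's theorem and fingerprints *)

Section Neighbourhoods.
Variables (V : finType) (e : rel V).
Implicit Types (A B S T U X Y : {set V}) (x y : V).

Definition nb U := \bigcup_(x in U) [set y | e x y].

Lemma nbP U y : reflect (exists2 x, x \in U & e x y) (y \in nb U).
Proof.
by apply: (iffP bigcupP) => -[x xU]; rewrite ?inE => exy; exists x; rewrite ?inE.
Qed.

Lemma nb1E x y : (y \in nb [set x]) = e x y.
Proof. by apply/nbP/idP => [[z /set1P ->]|exy] //; exists x; rewrite ?set11. Qed.

Lemma nbU S T : nb (S :|: T) = nb S :|: nb T.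
Proof.
apply/setP=> y; rewrite inE; apply/nbP/orP.
  by case=> x /setUP[xS|xT] exy; [left|right]; apply/nbP; exists x.
by case=> /nbP[x xS exy]; exists x; rewrite // inE xS ?orbT.
Qed.

Lemma nbS S T : S \subset T -> nb S \subset nb T.
Proof. by move=> sST; rewrite -(setUidPr sST) nbU subsetUl. Qed.

Lemma nb0 : nb set0 = set0.
Proof. by apply/setP=> y; rewrite inE; apply/nbP => -[x]; rewrite inE. Qed.

(** Induction on [#|A|]. A nonempty proper subset [S] with equality splits the task into [S] against
    [nb S :&: B] and [A :\: S] against [B :\: nb S]. Without such an [S], every nonempty proper
    subset has a neighbour to spare, so any edge at any [a] may be used and its ends deleted. *)
Lemma hall_matching A B :
  (forall S, S \subset A -> #|S| <= #|nb S :&: B|) ->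
  exists2 f : V -> V, {in A &, injective f} &
    forall x, x \in A -> f x \in B /\ e x (f x).
Proof.
have [n] := ubnP #|A|; elim: n A B => // n IHn A B ltAn hallAB.
have [->|/set0Pn[a aA]] := eqVneq A set0.
  by exists id => x; rewrite inE.
have [/exists_inP[S] | noS] := boolP [exists (S : {set V} | S \proper A),
    (S != set0) && (#|nb S :&: B| <= #|S|)].
  move=> sSA /andP[S0 tight].
  have ltSA := proper_card sSA.
  have [|T sTS|f1 f1I f1P] := IHn S (nb S :&: B); first by lia.
    rewrite setIA (setIidPl (nbS sTS)).
    by apply: hallAB; apply: subset_trans sTS (proper_sub sSA).
  have cSA : #|A :\: S| < #|A|.
    by rewrite cardsD (setIidPr (proper_sub sSA)) -card_gt0 in S0 *; lia.
  have [|T sTA|f2 f2I f2P] := IHn (A :\: S) (B :\: nb S); first by lia.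
    have [sTA' dTS] : T \subset A /\ [disjoint T & S].
      by apply/andP; rewrite -subsetD.
    have := hallAB (T :|: S); rewrite subUset sTA' (proper_sub sSA) => /(_ isT).
    rewrite cardsU disjoint_setI0 // cards0 subn0 nbU.
    have -> : (nb T :|: nb S) :&: B
            = (nb T :&: (B :\: nb S)) :|: (nb S :&: B).
      by apply/setP=> y; rewrite !inE; case: (y \in nb S); case: (y \in nb T); case: (y \in B).
    have := leq_card_setU (nb T :&: (B :\: nb S)) (nb S :&: B).
    by move=> /leP U1 U2; lia.
  exists (fun x => if x \in S then f1 x else f2 x) => [x y xA yA|x xA].
    have Dx z : z \in A -> z \notin S -> z \in A :\: S by rewrite inE => -> ->.
    case: ifPn => xS; case: ifPn => yS.
    - exact: f1I.
    - move=> E; have [+ _] := f1P _ xS; have [+ _] := f2P _ (Dx _ yA yS).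
      by rewrite -E !inE => /andP[/negPf->].
    - move=> E; have [+ _] := f1P _ yS; have [+ _] := f2P _ (Dx _ xA xS).
      by rewrite E !inE => /andP[/negPf->].
    - by apply: f2I; apply: Dx.
  case: ifPn => xS; first by have [] := f1P _ xS; rewrite inE => /andP[_ ->].
  by have [|] := f2P x; rewrite inE ?xS ?xA // => /andP[_ ->].
have [b /setIP[+ bB]] : exists b, b \in nb [set a] :&: B.
  by apply/set0Pn; rewrite -card_gt0 (leq_trans _ (hallAB _ _)) ?cards1 ?sub1set.
rewrite nb1E => eab.
have cA : #|A :\ a| < #|A| by rewrite [X in _ < X](cardsD1 a) aA.
have [|T sTA|f fI fP] := IHn (A :\ a) (B :\ b); first by lia.
  have [->|T0] := eqVneq T set0; first by rewrite cards0.
  have pT : T \proper A.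
    by apply: sub_proper_trans sTA _; rewrite properD1.
  move: noS; rewrite negb_exists_in => /forall_inP/(_ T pT).
  rewrite T0 /= -ltnNge => lt.
  have -> : nb T :&: (B :\ b) = (nb T :&: B) :\ b.
    by apply/setP=> y; rewrite !inE; case: (y == b); rewrite ?andbF.
  by have := cardsD1 b (nb T :&: B); case: (b \in _) => /=; lia.
exists (fun x => if x == a then b else f x) => [x y xA yA|x xA].
  have fb z : z \in A -> z != a -> f z != b.
    by move=> zA za; have [|] := fP z; rewrite !inE ?za // => /andP[].
  case: (eqVneq x a) => [->|xa]; case: (eqVneq y a) => [->|ya] //.
  - by move=> E; have := fb _ yA ya; rewrite -E eqxx.
  - by move=> E; have := fb _ xA xa; rewrite E eqxx.
  - by apply: fI; rewrite !inE ?xa ?ya.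
case: eqVneq => [->//|xa].
by have [|] := fP x; rewrite !inE ?xa // => /andP[_ ->].
Qed.

(* Greedily, as long as some vertex of U brings at least q new neighbours, add it. *)
Lemma fingerprint (q : nat) U : 0 < q -> U != set0 ->
  (forall x, q <= #|nb [set x]|) ->
  exists U0 : {set V}, [/\ U0 \subset U, U0 != set0, q * #|U0| <= #|nb U0| &
    forall x, x \in U -> #|nb [set x] :\: nb U0| < q].
Proof.
move=> q_gt0 /set0Pn[u uU] degq.
pose P S := (S \subset U) && (q * #|S| <= #|nb S|).
have Pu : P [set u] by rewrite /P sub1set uU cards1 muln1 degq.
case: (@arg_maxnP _ [set u] P (fun S => #|S|) Pu) => S /andP[sSU qS] Smax.
have S0 : S != set0.
  by rewrite -card_gt0 (leq_trans _ (Smax _ Pu)) ?cards1.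
exists S; split=> // x xU; rewrite ltnNge; apply/negP => qx.
have xS : x \notin S.
  apply: contraTN qx => xS; rewrite -ltnNge.
  have /eqP -> : nb [set x] :\: nb S == set0.
    by rewrite setD_eq0 nbS // sub1set.
  by rewrite cards0.
have := Smax (x |: S); rewrite cardsU1 xS /= /P subUset sub1set xU sSU /=.
rewrite cardsU1 xS nbU /= => /(_ _); rewrite ltnn => ltn; apply: notF; apply: ltn.
have -> : nb [set x] :|: nb S = (nb [set x] :\: nb S) :|: nb S.
  by apply/setP=> y; rewrite !inE; case: (y \in nb S); rewrite ?orbT ?orbF.
rewrite cardsU (_ : _ :&: _ = set0) ?cards0 ?subn0; first by lia.
by apply/setP=> y; rewrite !inE; case: (y \in nb S); rewrite ?andbF.
Qed.

End Neighbourhoods.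

(** * Matchings between good sets *)

(* The two consequences of the expander mixing lemma that are needed, with
   c standing for d / lambda and all denominators cleared. *)
Definition mixing (V : finType) (e : rel V) (d c : nat) : Prop :=
  (forall s (X Y : {set V}),
     (forall x, x \in X -> d <= s * #|nb e [set x] :&: Y|) ->
     2 * s * #|Y| <= #|V| -> c ^ 2 * #|X| <= 4 * s ^ 2 * #|Y|) /\
  (forall s (X Y : {set V}),
     (forall x, x \in X -> s * #|nb e [set x] :&: Y| <= d) ->
     2 * #|V| <= s * #|Y| -> c ^ 2 * #|X| * #|Y| <= 4 * #|V| ^ 2).

Section GoodSets.
Variables (V : finType) (e : rel V) (d c g q l K : nat).
Implicit Types (S T U W X Y : {set V}).
Local Notation n := #|V|.
Local Notation N x := (nb e [set x]).

Definition admissible U := (U != set0) && (q * #|U| <= #|nb e U|).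

(* Every nonempty set S lies in core U for some admissible U contained in S (fingerprint), and
   admissible sets are few; a property of the pair (nb e U, core U) that holds for
   all admissible U therefore controls all sets S. *)
Definition core U := [set x | #|N x :\: nb e U| < q].

Definition good_set (kappa : nat) W := forall U, admissible U ->
  [/\ #|nb e U| <= kappa * l * #|W :&: nb e U|,
      4 * #|nb e U| <= n -> 64 * l * #|core U :&: W| <= #|nb e U|,
      g * #|core U| < n -> 256 * #|core U :&: W| < K &
      g * #|~: nb e U| < n -> 256 * #|W :\: nb e U| < K].

Hypotheses (e_sym : symmetric e) (deg : forall x, #|N x| = d).
Hypothesis mix : mixing e d c.
Hypotheses (q_gt0 : 0 < q) (gq : 2 * g * q <= d) (g_ge2 : 1 < g) (gc : 2 * g < c).

Lemma leq_qd : q <= d.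
Proof. by apply: leq_trans gq; rewrite leq_pmull // muln_gt0 (ltnW g_ge2). Qed.

Hypotheses (n_gt0 : 0 < n) (l_gt0 : 0 < l).

(** A vertex of [core U] has fewer than [q <= d / (2 g)] neighbours outside [nb e U]. If both sets
    had at least [n / g] elements, the second mixing bound would give [c <= 2 g]. *)
Lemma core_or_compl U : (g * #|core U| < n) || (g * #|~: nb e U| < n).
Proof.
rewrite -implyNb -leqNgt; apply/implyP => gZ; rewrite ltnNge; apply/negP => gY.
have h1 x : x \in core U -> 2 * g * #|N x :&: ~: nb e U| <= d.
  rewrite inE -setDE => ltq; apply: leq_trans gq.
  by rewrite leq_mul2l (ltnW ltq) orbT.
have h2 : 2 * n <= 2 * g * #|~: nb e U| by rewrite -mulnA leq_mul2l.
have := mix.2 _ _ _ h1 h2.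
move: gZ gY gc n_gt0; move: #|core U| #|~: nb e U| #|V| => z y m.
move=> gZ gY gc' m0 le.
have h3 : c ^ 2 * (m * m) <= 4 * g ^ 2 * m ^ 2.
  apply: leq_trans (_ : c ^ 2 * (g * z * (g * y)) <= _).
    by rewrite leq_mul2l leq_mul ?orbT.
  have -> : c ^ 2 * (g * z * (g * y)) = g ^ 2 * (c ^ 2 * z * y) by lia.
  have -> : 4 * g ^ 2 * m ^ 2 = g ^ 2 * (4 * m ^ 2) by lia.
  by rewrite leq_mul2l le orbT.
have h4 : (2 * g) ^ 2 < c ^ 2 by rewrite ltn_sqr.
have : c ^ 2 * m ^ 2 <= (2 * g) ^ 2 * m ^ 2 by move: h3; rewrite expnMn.
by rewrite leq_pmul2r ?expn_gt0 ?m0 // leqNgt h4.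
Qed.

(** As [2 q <= d], a vertex of [core U] has at least half of its neighbours in [nb e U]: the first
    mixing bound applies with [s = 2]. *)
Lemma core_small U : 4 * #|nb e U| <= n -> c ^ 2 * #|core U| <= 16 * #|nb e U|.
Proof.
move=> Y4; apply: (mix.1 2) => // x; rewrite inE => ltq.
have q2 : 2 * q <= d by apply: leq_trans gq; rewrite leq_mul2r (leq_pmulr 2 (ltnW g_ge2)) orbT.
have := cardsID (nb e U) (N x); rewrite deg; move: ltq q2; clear.
by move: #|_| #|_| => y z; lia.
Qed.

(** Let [U] be a fingerprint of [S]. Then [W'] contains at least [#|nb e U| / (64 l)] vertices of
    [nb e U], hence of [nb e S]. If [4 #|nb e U| <= n], this is at least [#|core U :&: W| >= #|S|];
    otherwise it is at least [K / 256]. *)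
Lemma good_expand kappa W W' S : kappa <= 64 -> good_set kappa W ->
  good_set kappa W' -> K * l <= n -> S \subset W ->
  256 * #|S| <= K -> #|S| <= #|nb e S :&: W'|.
Proof.
move=> k64 gW gW' Kl sSW SK.
have [->|S0] := eqVneq S set0; first by rewrite cards0.
have [|U [sUS U0 qU Ucore]] := fingerprint q_gt0 S0 (e := e).
  by move=> x; rewrite deg leq_qd.
have aU : admissible U by rewrite /admissible U0 qU.
have [_ /(_ _)b _ _] := gW _ aU; have [a _ _ _] := gW' _ aU.
have sS : S \subset core U :&: W.
  by rewrite subsetI sSW andbT; apply/subsetP => x /Ucore; rewrite inE.
have := subset_leq_card sS => leS.
have : #|W' :&: nb e U| <= #|nb e S :&: W'|.
  by rewrite setIC subset_leq_card // setSI // nbS.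
move: a b leS; move: #|W' :&: _| #|core U :&: W| #|nb e U| #|nb e S :&: _|.
move=> w' z y t a b leS; apply: leq_trans.
have a' : y <= 64 * l * w' by apply: leq_trans a _; rewrite -!mulnA leq_mul2r k64 orbT.
have [y4|y4] := leqP (4 * y) n.
  have := leq_trans (b y4) a'.
  by rewrite leq_pmul2l ?muln_gt0 //; apply: leq_trans.
have : K * l <= 256 * l * w' by lia.
rewrite mulnAC leq_pmul2r //; lia.
Qed.

(** For [S] above [K / 256], its fingerprint has a core that is large in [W], so by [core_or_compl]
    the part [T] of [W'] outside [nb e S] is below [K / 256]. Expanding [T] back into [W :\: S]
    gives [#|T| <= K - #|S|], which is Hall's condition for [S]. *)
Lemma good_matching kappa W W' : kappa <= 64 -> good_set kappa W ->
  good_set kappa W' -> K * l <= n -> #|W| = K -> #|W'| = K ->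
  exists2 f : V -> V, {in W &, injective f} & 
    forall x, x \in W -> f x \in W' /\ e x (f x).
Proof.
move=> k64 gW gW' Kl cW cW'; apply: hall_matching => S sSW.
have [SK|SK] := leqP (256 * #|S|) K; first exact: (good_expand k64 gW).
have ST : 256 * #|W' :\: nb e S| < K.
  have S0 : S != set0 by rewrite -card_gt0; lia.
  have [|U [sUS U0 qU Ucore]] := fingerprint q_gt0 S0 (e := e).
    by move=> x; rewrite deg leq_qd.
  have aU : admissible U by rewrite /admissible U0 qU.
  have [_ _ b _] := gW _ aU; have [_ _ _ c'] := gW' _ aU.
  have sS : S \subset core U :&: W.
    by rewrite subsetI sSW andbT; apply/subsetP => x /Ucore; rewrite inE.
  have leS := subset_leq_card sS.
  case/orP: (core_or_compl U) => [/b|/c']; first by lia.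
  by apply: leq_ltn_trans; rewrite leq_mul2l subset_leq_card ?orbT // setDS // nbS.
set T := W' :\: nb e S in ST.
have := @good_expand _ _ _ T k64 gW' gW Kl (subsetDl _ _) (ltnW ST).
have : #|nb e T :&: W| <= #|W :\: S|.
  apply/subset_leq_card/subsetP => x /setIP[/nbP[y /setDP[_ yS] eyx] xW].
  rewrite inE xW andbT; apply: contra yS => xS.
  by apply/nbP; exists x; rewrite // e_sym.
have := cardsID (nb e S) W'; have := cardsID S W.
by rewrite (setIidPr sSW) -/T setIC; lia.
Qed.
End GoodSets.

(** * Extendable forests *)

Section Linking.
Variables (V : finType) (e : rel V) (R : {set V}) (m : nat).
Implicit Types (L : {set V * V}) (U T : {set V}) (x y : V) (p q : seq V).
Local Notation nb := (nb e).

Definition children L := [set a.2 | a in L].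

Definition outdeg L x := #|[set a in L | a.1 == x]|.

(* A set L of (parent, child) pairs with distinct children in R is extendable in
   the sense of Friedman and Pippenger (with branching number 3) when every small
   set U still has enough unused neighbours in R. *)
Definition extendable L : Prop :=
  [/\ {in L &, injective (@snd V V)},
      forall a, a \in L -> e a.1 a.2 && (a.2 \in R) &
      forall U, #|U| <= 2 * m ->
        3 * #|U| <= #|nb U :&: (R :\: children L)| + #|[set a in L | a.1 \in U]|].

Hypothesis joined : forall U T, m <= #|U| -> m <= #|T| ->
  exists x y, [/\ x \in U, y \in T & e x y].
Hypothesis m_gt0 : 0 < m.

Lemma mem_children L a : a \in L -> a.2 \in children L.
Proof. exact: imset_f. Qed.

Lemma extendable_sub L L' : L' \subset L -> extendable L -> extendable L'.
Proof.
move=> sL [inj eR ext]; split=> [a b aL bL||U cU].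
- exact: inj (subsetP sL _ aL) (subsetP sL _ bL).
- by move=> a /(subsetP sL)/eR.
apply: leq_trans (ext U cU) _.
pose D := [set a in L :\: L' | a.1 \in U].
have -> : #|[set a in L | a.1 \in U]| = #|[set a in L' | a.1 \in U]| + #|D|.
  rewrite -(cardsID L'); congr (_ + _); apply: eq_card => a; rewrite !inE.
    have := subsetP sL a.
    by case: (a \in L') => [->//|_]; rewrite ?andbF ?andbT.
  by case: (a \in L') => //=; rewrite ?andbF ?andbT.
rewrite addnA [_ + #|D|]addnAC leq_add2r.
have <- : #|[set a.2 | a in D]| = #|D|.
  rewrite card_in_imset // => a b; rewrite !inE => /andP[/andP[_ aL] _].
  by move=> /andP[/andP[_ bL] _]; apply: inj.
rewrite -cardsUI (_ : _ :&: [set a.2 | a in D] = set0) ?cards0 ?addn0.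
  apply/subset_leq_card/subsetP => y /setUP[|/imsetP[a]].
    rewrite !in_setI !in_setD => /and3P[-> + ->]; rewrite andbT /=.
    by apply: contra => /imsetP[a /(subsetP sL) aL ->]; apply: mem_children.
  rewrite !inE => /andP[/andP[aL' aL] aU] ->.
  have /andP[ea aR] := eR _ aL.
  rewrite aR andbT; apply/andP; split; first by apply/nbP; exists a.1.
  apply: contra aL' => /imsetP[b bL' Eab].
  by rewrite (inj a b aL (subsetP sL _ bL') Eab).
apply/setP=> y; rewrite in_set0; apply/negP => /setIP[].
rewrite !in_setI !in_setD => /and3P[_ + _] /imsetP[a]; rewrite !inE.
move=> + /andP[/andP[_ aL] _] Ey; rewrite Ey => /negP; apply.
exact: mem_children.
Qed.

(** If a free neighbour [y] of [x] cannot be added, then [y] lies in [nb U] for a tight [U] avoiding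
    [x]. Tight sets are closed under union by submodularity of [f], so one tight [T] covers all free
    neighbours of [x]. Then [x |: T] violates the condition, since it gains at most
    [outdeg L x <= 2] where 3 are required. *)
Lemma extendable_add_leaf L x : extendable L -> outdeg L x <= 2 ->
  #|L| + 7 * m <= #|R| ->
  exists y, [/\ y \in R, y \notin children L, e x y &
    extendable ((x, y) |: L)].
Proof.
move=> [inj eR ext] degx Lm.
set F := R :\: children L in ext.
pose f U := #|nb U :&: F|; pose o U := #|[set a in L | a.1 \in U]|.
have cF : 7 * m <= #|F|.
  have := cardsD R (children L).
  have := subset_leq_card (subsetIr R (children L)).
  have cL : #|children L| <= #|L| by exact: leq_imset_card.
  rewrite -/F; lia.
have fsub A B : f (A :|: B) + f (A :&: B) <= f A + f B.
  rewrite /f nbU setIUl -[X in _ <= X]cardsUI leq_add2l.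
  apply/subset_leq_card; rewrite -setIIl setSI //.
  by rewrite subsetI !nbS ?subsetIl ?subsetIr.
have omod A B : o (A :|: B) + o (A :&: B) = o A + o B.
  by rewrite /o -[RHS]cardsUI; congr (_ + _); apply: eq_card => a; rewrite !inE;
    case: (a \in L).
pose tight U := [&& #|U| <= 2 * m, x \notin U & 3 * #|U| == f U + o U].
(* A set of size [m] or more misses fewer than [m] of the at least [7 m] free vertices, so
   [f U > 6 m >= 3 #|U|] and [U] is not tight. Hence a union of two tight sets stays within the size
   [2 m] that [extendable] controls. *)
have tight_small U : tight U -> #|U| < m.
  move=> /and3P[cU _ /eqP tU]; rewrite ltnNge; apply/negP => mU.
  have := cardsID (nb U) F; rewrite setIC -/(f U).
  have [mF|] := leqP m #|F :\: nb U|; last by lia.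
  have [u [y [uU /setDP[_ /negP]]]] := joined mU mF.
  by move=> yn euy; case: yn; apply/nbP; exists u.
have tightU A B : tight A -> tight B -> tight (A :|: B).
  move=> tA tB; have := tight_small _ tA; have := tight_small _ tB.
  case/and3P: tA => cA xA /eqP eA; case/and3P: tB => cB xB /eqP eB ltB ltA.
  have cAB := cardsUI A B; have sAB := fsub A B; have mAB := omod A B.
  have cU : #|A :|: B| <= 2 * m by lia.
  have cI : #|A :&: B| <= 2 * m by lia.
  rewrite /tight cU inE negb_or xA xB /= eqn_leq ext //=.
  have := ext _ cI; rewrite -/(f _) -/(o _); lia.
have tight0 : tight set0.
  rewrite /tight cards0 /f nb0 set0I cards0 inE /= /o.
  by apply/eqP; rewrite muln0 (_ : [set a in L | _] = set0) ?cards0 //; apply/setP=> a; rewrite !inE andbF.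
have [T tT Tmax] := @arg_maxnP _ set0 tight (fun U => #|U|) tight0.
have subT U : tight U -> U \subset T.
  move=> tU; have := Tmax _ (tightU _ _ tT tU) => /= le.
  have /eqP -> : T == T :|: U by rewrite eqEcard subsetUl le.
  exact: subsetUr.
(* This is the extension condition after adding [(x, y)]: [y] is no longer free, and sets containing
   [x] gain one used child. *)
pose good y := [forall U : {set V}, (#|U| <= 2 * m) ==>
  (3 * #|U| <= #|nb U :&: (F :\ y)| + (o U + (x \in U)))].
have [/exists_inP[y /setIP[+ yF] /forallP gy]|] :=
    boolP [exists y in nb [set x] :&: F, good y].
  move: (yF); rewrite inE nb1E => /andP[ych yR] exy.
  exists y; split=> //.
  have xyL : (x, y) \notin L by apply: contra ych; apply: mem_children.
  split=> [a b|a|U cU].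
  - rewrite !inE => /predU1P[->|aL] /predU1P[->|bL] //= E; try exact: inj.
      by case/negP: ych; rewrite E mem_children.
    by case/negP: ych; rewrite -E mem_children.
  - by rewrite !inE => /predU1P[->|/eR //]; rewrite /= exy.
  have := gy U; rewrite cU => /leq_trans; apply; apply: leq_add.
    apply/subset_leq_card/setIS; apply/subsetP => z.
    rewrite !inE => /and3P[zy zch ->]; rewrite andbT.
    apply: contra zch => /imsetP[a]; rewrite !inE => /predU1P[-> /= Ez|aL ->].
      by rewrite Ez eqxx in zy.
    exact: mem_children.
  rewrite /o; case xU: (x \in U); last first.
    rewrite addn0; apply/subset_leq_card/subsetP => a; rewrite !inE.
    by case/andP=> -> ->; rewrite orbT.
  have -> : [set a in (x, y) |: L | a.1 \in U] = (x, y) |: [set a in L | a.1 \in U].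
    by apply/setP=> a; rewrite !inE; case: eqP => [->|//]; rewrite /= xU.
  by rewrite cardsU1 inE (negPf xyL) addnC.
rewrite negb_exists_in => /forall_inP none.
suff: nb [set x] :&: F \subset nb T.
  move=> sub; have := tight_small _ tT.
  case/and3P: (tT) => cT xT /eqP eT ltT.
  have cxT : #|x |: T| <= 2 * m by rewrite cardsU1 xT; lia.
  have := ext _ cxT; rewrite -/(f _) -/(o _) cardsU1 xT.
  have -> : f (x |: T) = f T.
    by rewrite /f nbU setIUl (setUidPr _) // subsetI sub subsetIr.
  have := omod [set x] T; rewrite (_ : [set x] :&: T = set0); last first.
    by apply/setP=> z; rewrite !inE; case: eqP => // ->; rewrite (negPf xT).
  have -> : o set0 = 0.
    by apply/eqP; rewrite cards_eq0; apply/eqP/setP=> a; rewrite !inE andbF.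
  have -> : o [set x] = outdeg L x.
    by apply: eq_card => a; rewrite !inE.
  by lia.
apply/subsetP => y yNF; have /setIP[exy yF] := yNF.
have := none y yNF; rewrite negb_forall => /existsP[U].
rewrite negb_imply -ltnNge => /andP[cU].
have := ext U cU; rewrite -/(f _) -/(o _).
have := cardsD1 y (nb U :&: F); rewrite -setIDA -/(f _) inE yF andbT.
move=> fE extU lt; have [yU xU tU] : [/\ y \in nb U, x \notin U & 3 * #|U| == f U + o U].
  by move: fE lt extU; case: (y \in _); case: (x \in _) => /= fE lt extU; split=> //; lia.
by have /subT/nbS/subsetP -> : tight U by rewrite /tight cU xU.
Qed.

Definition steps x p := [set a in zip (x :: p) p].

Lemma steps_cons x y p : steps x (y :: p) = (x, y) |: steps y p.
Proof. by apply/setP=> a; rewrite !inE. Qed.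

Lemma childrenU L L' : children (L :|: L') = children L :|: children L'.
Proof. exact: imsetU. Qed.

Lemma childrenS L L' : L \subset L' -> children L \subset children L'.
Proof. exact: imsetS. Qed.

Lemma childrenU1 a L : children (a |: L) = a.2 |: children L.
Proof. exact: imsetU1. Qed.

Lemma children_steps x p : children (steps x p) = [set y in p].
Proof.
elim: p x => [|y p IHp] x; last by rewrite steps_cons childrenU1 IHp; apply/setP=> z; rewrite !inE.
by apply/setP=> z; rewrite !inE; apply/imsetP => -[a]; rewrite inE.
Qed.

(* The vertices to which a new child may be attached. *)
Definition known L x := (x \notin R) || (x \in children L).

Definition rooted L : Prop := forall a, a \in L -> known L a.1.

Lemma outdeg_fresh L x : rooted L -> x \in R -> x \notin children L -> outdeg L x = 0.
Proof.
move=> rL xR xch; apply/eqP; rewrite cards_eq0; apply/eqP/setP=> a; rewrite !inE.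
by apply/negP => /andP[/rL + /eqP ax]; rewrite /known ax xR (negPf xch).
Qed.

Lemma children_sub L : extendable L -> children L \subset R.
Proof. by case=> _ eR _; apply/subsetP=> _ /imsetP[a /eR/andP[_ aR] ->]. Qed.

Lemma card_setU1_le (a : V * V) L : #|a |: L| <= #|L|.+1.
Proof. by rewrite cardsU1; case: (_ \notin _). Qed.

Lemma outdegU1 L x y z : outdeg ((x, y) |: L) z <= (x == z) + outdeg L z.
Proof.
rewrite /outdeg; case: eqP => [->|xz].
  rewrite add1n; apply: leq_trans (_ : #|(z, y) |: [set a in L | a.1 == z]| <= _).
    by apply/subset_leq_card/subsetP => a; rewrite !inE; case: eqP.
  by rewrite cardsU1; case: (_ \notin _).
rewrite add0n; apply/subset_leq_card/subsetP => a; rewrite !inE.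
by case: eqP => [->|//]; rewrite /= => /eqP.
Qed.

Lemma outdegU L L' z : outdeg (L :|: L') z <= outdeg L z + outdeg L' z.
Proof.
apply: leq_trans (leq_card_setU _ _).
by apply/subset_leq_card/subsetP => a; rewrite !inE => /andP[/orP[->|->] ->]; rewrite ?orbT.
Qed.

(** A full binary tree of depth [h] is grown leaf by leaf. Two new children under the limit of three
    are possible because [x] starts with outdegree at most 1. The tree has [2 ^ h.+1 - 2] edges. *)
Lemma extendable_tree h L x : extendable L -> rooted L -> known L x ->
  outdeg L x <= 1 -> #|L| + 7 * m + 2 ^ h.+1 <= #|R| ->
  exists (L1 : {set V * V}) (F : {set V}), [/\ extendable (L1 :|: L), [disjoint children L1 & children L],
      forall a, a \in L1 -> a.1 \in x |: children L1 & #|L1| + 2 <= 2 ^ h.+1] /\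
    [/\ #|F| = 2 ^ h, F \subset x |: children L1 & forall z, z \in F ->
      exists p, [/\ size p = h, path e x p, last x p = z, uniq p &
        steps x p \subset L1]].
Proof.
elim: h L x => [|h IHh] L x extL rL kx dx cL.
  exists set0, [set x]; split; split=> //.
  - by rewrite set0U.
  - by rewrite /children imset0 -setI_eq0 set0I.
  - by move=> a; rewrite inE.
  - by rewrite cards0.
  - by rewrite cards1.
  - by rewrite subsetUl.
  by move=> z /set1P ->; exists [::]; split=> //; apply/subsetP=> a; rewrite inE.
rewrite !(expnS 2 h.+1) in cL *; set M := 2 ^ h.+1 in cL IHh *.
have ME : M = 2 * 2 ^ h by rewrite /M expnS.
have M_gt1 : 2 <= M by rewrite ME leq_pmulr // expn_gt0.
clearbody M.
have [|y1 [y1R y1L exy1 ext1]] := extendable_add_leaf extL (leqW dx); first by lia.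
pose La : {set V * V} := (x, y1) |: L.
rewrite -/La in ext1.
have cLa : #|La| <= #|L|.+1 by apply: card_setU1_le.
have xy1 : x != y1 by apply: contraTneq kx => ->; rewrite /known y1R.
have chLa : children La = y1 |: children L by rewrite childrenU1.
have dLa z : outdeg La z <= (x == z) + outdeg L z by exact: outdegU1.
have [||y2 [y2R y2L exy2 ext2]] := @extendable_add_leaf La x ext1.
- by rewrite (leq_trans (dLa x)) // eqxx; lia.
- by lia.
pose Lb : {set V * V} := (x, y2) |: La.
rewrite -/Lb in ext2.
have cLb : #|Lb| <= #|La|.+1 by apply: card_setU1_le.
have chLb : children Lb = y2 |: (y1 |: children L) by rewrite childrenU1 chLa.
have dLb z : outdeg Lb z <= (x == z) + (x == z) + outdeg L z.
  by have := outdegU1 La x y2 z; have := dLa z; rewrite -/Lb; clear; lia.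
rewrite chLa !inE negb_or in y2L; case/andP: y2L => y21 y2L.
have xy2 : x != y2 by apply: contraTneq kx => ->; rewrite /known y2R.
have rLb : rooted Lb.
  move=> a; rewrite !inE /known chLb !inE; case: (eqVneq a (x, y2)) => [-> _|_] /=.
    by case/orP: kx => ->; rewrite ?orbT.
  case: (eqVneq a (x, y1)) => [-> _|_] /=.
    by case/orP: kx => ->; rewrite ?orbT.
  by move=> /rL /orP[->|->]; rewrite ?orbT.
have dy z : z \in R -> z \notin children L -> z != x -> outdeg Lb z = 0.
  move=> zR zL zx; apply/eqP; rewrite -leqn0 (leq_trans (dLb z)) //.
  by rewrite eq_sym (negPf zx) (outdeg_fresh rL zR zL).
have [|||L1 [F1 [[extL1 dis1 par1 cL1] [cF1 sF1 pF1]]]] := IHh Lb y1 ext2 rLb.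
- by rewrite /known chLb !inE eqxx !orbT.
- by rewrite dy // eq_sym.
- by clear -cL cLa cLb M_gt1; lia.
have chL1R : children L1 \subset R.
  by apply: subset_trans (children_sub extL1); rewrite childrenU subsetUl.
have chL1 z : z \in children Lb -> z \notin children L1.
  by move=> zb; apply/negP => z1; have := disjointFr dis1 z1; rewrite zb.
have y1Lb : y1 \in children Lb by rewrite chLb !inE eqxx orbT.
have y2Lb : y2 \in children Lb by rewrite chLb !inE eqxx.
have chLL : children (L1 :|: Lb) = children L1 :|: children Lb by exact: childrenU.
have r1 : rooted (L1 :|: Lb).
  move=> a; rewrite inE => /orP[/par1|/rLb]; rewrite /known chLL !inE.
    by case/orP=> [/eqP->|->]; rewrite ?y1Lb ?orbT.
  by case/orP=> ->; rewrite ?orbT.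
have c1 : #|L1 :|: Lb| <= #|L1| + #|Lb| by rewrite leq_card_setU.
have [|||L2 [F2 [[extL2 dis2 par2 cL2] [cF2 sF2 pF2]]]] := IHh (L1 :|: Lb) y2 extL1 r1.
- by rewrite /known chLL inE y2Lb !orbT.
- apply: leq_trans (outdegU _ _ _) _; rewrite (dy y2) ?addn0 //; last by rewrite eq_sym.
  rewrite /outdeg (_ : [set a in L1 | _] = set0) ?cards0 //.
  apply/setP=> a; rewrite !inE; apply/negP => /andP[/par1 + /eqP a1].
  by rewrite a1 !inE (negPf y21) (negPf (chL1 _ y2Lb)).
- by clear -cL cLa cLb c1 cL1; lia.
have chL2 z : z \in children (L1 :|: Lb) -> z \notin children L2.
  by move=> zb; apply/negP => z1; have := disjointFr dis2 z1; rewrite zb.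
pose L3 := L2 :|: (L1 :|: [set (x, y2); (x, y1)]).
have E3 : L3 :|: L = L2 :|: (L1 :|: Lb) by rewrite /L3 /Lb /La !setUA.
have ch3 : children L3 = children L2 :|: (children L1 :|: [set y2; y1]).
  by rewrite !childrenU /children imset_set1 imset_set1.
exists L3, (F1 :|: F2); split; split.
- by rewrite E3.
- rewrite ch3 -setI_eq0; apply/eqP/setP=> z; rewrite !inE; apply/negP => /andP[+ zL].
  have zb : z \in children Lb by rewrite chLb !inE zL !orbT.
  rewrite (negPf (chL1 _ zb)) (negPf (chL2 _ _)) /=; last by rewrite chLL inE zb orbT.
  by case/orP=> /eqP zy; move: zL; rewrite zy ?(negPf y1L) ?(negPf y2L).
- move=> a; rewrite ch3 !inE => /or3P[/par2|/par1|].
  + by rewrite !inE => /orP[->|->]; rewrite ?orbT.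
  + by rewrite !inE => /orP[->|->]; rewrite ?orbT.
  + by case/orP => /eqP -> /=; rewrite eqxx.
- have c3 : #|L3| <= #|L2| + (#|L1| + 2).
    rewrite (leq_trans (leq_card_setU _ _)) // leq_add2l.
    rewrite (leq_trans (leq_card_setU _ _)) // leq_add2l.
    by rewrite cards2; case: (_ != _).
  by clear -c3 cL1 cL2; lia.
- rewrite cardsU cF1 cF2 (_ : F1 :&: F2 = set0) ?cards0 ?subn0 ?ME ?addnn -?mul2n //.
  apply/setP=> z; rewrite !inE; apply/negP => /andP[/(subsetP sF1) + /(subsetP sF2)].
  rewrite !inE => /predU1P[->|z1].
    by rewrite eq_sym (negPf y21) (negPf (chL2 _ _)) // chLL inE y1Lb orbT.
  rewrite (negPf (chL2 z _)) ?chLL ?inE ?z1 // orbF => /eqP zy.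
  by move: z1; rewrite zy (negPf (chL1 _ y2Lb)).
- apply/subsetP=> z; rewrite ch3 !inE => /orP[/(subsetP sF1)|/(subsetP sF2)];
    by rewrite !inE => /orP[->|->]; rewrite ?orbT.
move=> z; rewrite inE => /orP[/pF1|/pF2] [p [sp pp lp up stp]].
  exists (y1 :: p); split=> //=; rewrite ?sp ?exy1 //.
    rewrite up andbT; apply/negP => y1p.
    have : y1 \in children (steps y1 p) by rewrite children_steps inE.
    by move=> /(subsetP (childrenS stp)); rewrite (negPf (chL1 _ y1Lb)).
  by rewrite steps_cons /L3; apply/subsetP=> a; rewrite in_setU1 => /predU1P[->|/(subsetP stp)aL];
    rewrite !inE ?eqxx ?aL ?orbT.
exists (y2 :: p); split=> //=; rewrite ?sp ?exy2 //.
  rewrite up andbT; apply/negP => y2p.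
  have : y2 \in children (steps y2 p) by rewrite children_steps inE.
  move=> /(subsetP (childrenS stp)); rewrite (negPf (chL2 _ _)) //.
  by rewrite chLL inE y2Lb orbT.
by rewrite steps_cons /L3; apply/subsetP=> a; rewrite in_setU1 => /predU1P[->|/(subsetP stp)aL];
    rewrite !inE ?eqxx ?aL ?orbT.
Qed.

Lemma rootedU L L' x : rooted L -> known L x ->
  (forall a, a \in L' -> a.1 \in x |: children L') -> rooted (L' :|: L).
Proof.
move=> rL kx par a; rewrite in_setU /known childrenU in_setU => /orP[/par|/rL].
  rewrite in_setU1 => /orP[/eqP->|->]; rewrite ?orbT //.
  by case/orP: kx => ->; rewrite ?orbT.
by case/orP=> ->; rewrite ?orbT.
Qed.

Lemma steps_parent x p a : a \in steps x p -> a.1 \in x :: p.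
Proof.
elim: p x => [|y p IHp] x; first by rewrite inE.
rewrite steps_cons in_setU1 => /predU1P[-> |/IHp]; first exact: mem_head.
by rewrite [in X in _ -> X]inE => ->; rewrite orbT.
Qed.

Lemma outdeg_steps x p z : uniq (x :: p) -> outdeg (steps x p) z <= (z \in x :: p).
Proof.
elim: p x => [|y p IHp] x.
  move=> _; rewrite /outdeg (_ : [set a in _ | _] = set0) ?cards0 //.
  by apply/setP=> a; rewrite !inE.
move=> /= /andP[xp up]; rewrite steps_cons.
apply: leq_trans (outdegU1 _ _ _ _) _.
have := IHp y up; rewrite [z \in [:: x, y & p]]in_cons [z == x]eq_sym; case: eqP => [<-|_]; last by rewrite add0n.
by rewrite (negPf xp) leqn0 => /eqP ->.
Qed.

(** Trees with [2 ^ h >= m] leaves are grown from [x] and from [y]; [joined] gives an edge between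
    their leaves, and all but the two branches to it are discarded. So the link costs [2 h]
    vertices, and the room [2 ^ h.+2] is only borrowed. *)
Lemma extendable_connect h L x y : extendable L -> rooted L ->
  known L x -> known L y -> x != y -> outdeg L x <= 1 -> outdeg L y <= 1 ->
  m <= 2 ^ h -> #|L| + 7 * m + 2 ^ h.+2 <= #|R| ->
  exists p q L', [/\ [/\ size p = h, size q = h, path e x p, path e y q &
      e (last x p) (last y q)],
    uniq (p ++ q), extendable L' /\ rooted L',
      children L' = [set z in p ++ q] :|: children L &
      [disjoint [set z in p ++ q] & children L] /\
      forall z, outdeg L' z <= outdeg L z + (z \in x :: y :: p ++ q)].
Proof.
move=> extL rL kx ky xy dx dy mh; rewrite (expnS 2 h.+1); set M := 2 ^ _ => cL.
have [|L1 [F1 [[ext1 dis1 par1 c1] [cF1 sF1 pF1]]]] :=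
    extendable_tree extL rL kx dx (h := h); first by rewrite -/M; clear -cL; lia.
rewrite -/M in c1; have r1 := rootedU rL kx par1.
have ch1 : children L1 \subset R.
  by apply: subset_trans (children_sub ext1); rewrite childrenU subsetUl.
have kxN z : known L z -> z \notin children L1.
  case/orP=> kz; first by apply: contra kz; apply: (subsetP ch1).
  by apply/negP => z1; have := disjointFr dis1 z1; rewrite kz.
have ky1 : known (L1 :|: L) y.
  by rewrite /known childrenU inE; case/orP: ky => ->; rewrite ?orbT.
have dy1 : outdeg (L1 :|: L) y <= 1.
  apply: leq_trans (outdegU _ _ _) _; rewrite /outdeg (_ : [set a in L1 | _] = set0).
    by rewrite cards0.
  apply/setP=> a; rewrite !inE; apply/negP => /andP[/par1 + /eqP a1].
  by rewrite a1 !inE (negPf (kxN _ ky)) orbF eq_sym (negPf xy).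
have cLU : #|L1 :|: L| <= #|L1| + #|L| by rewrite leq_card_setU.
have [|L2 [F2 [[ext2 dis2 par2 c2] [cF2 sF2 pF2]]]] :=
    extendable_tree ext1 r1 ky1 dy1 (h := h); first by rewrite -/M; clear -cL c1 cLU; lia.
have [u [v [uF1 vF2 euv]]] : exists u v, [/\ u \in F1, v \in F2 & e u v].
  by apply: joined; rewrite ?cF1 ?cF2.
have [p [sp pp lp up stp]] := pF1 u uF1.
have [q [sq pq lq uq stq]] := pF2 v vF2.
have sp1 z : z \in p -> z \in children L1.
  by move=> zp; apply: (subsetP (childrenS stp)); rewrite children_steps inE.
have sq2 z : z \in q -> z \in children L2.
  by move=> zq; apply: (subsetP (childrenS stq)); rewrite children_steps inE.
have pL z : z \in p -> z \notin children L.
  by move=> /sp1 zp; rewrite (disjointFr dis1 zp).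
have qL z : z \in q -> (z \notin children L) && (z \notin children L1).
  by move=> /sq2 zq; have := disjointFr dis2 zq; rewrite childrenU inE => /norP[-> ->].
pose L' := steps y q :|: (steps x p :|: L).
have par_st z r : forall a, a \in steps z r -> a.1 \in z |: children (steps z r).
  by move=> a /steps_parent; rewrite children_steps !inE.
have xp : x \notin p by apply/negP => /sp1; rewrite (negPf (kxN _ kx)).
have ch2 : children L2 \subset R.
  by apply: subset_trans (children_sub ext2); rewrite childrenU subsetUl.
have yq : y \notin q.
  apply/negP => yq; have /andP[yL _] := qL _ yq; case/orP: ky => [|yL']; last by rewrite yL' in yL.
  by rewrite (subsetP ch2) // sq2.
exists p, q, L'; split.
- by split=> //; rewrite lp lq.
- rewrite cat_uniq up uq andbT; apply/hasPn => z /= /qL/andP[_].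
  by apply: contra => /sp1.
- split; first by apply: extendable_sub ext2; rewrite setUSS // setSU.
  apply: rootedU (par_st y q); last first.
    by rewrite /known childrenU inE; case/orP: ky => ->; rewrite ?orbT.
  exact: rootedU (par_st x p).
- rewrite !childrenU !children_steps; apply/setP=> z; rewrite !inE mem_cat.
  by rewrite orbA [(z \in q) || _]orbC.
split.
  rewrite -setI_eq0; apply/eqP/setP=> z; rewrite in_set0 in_setI inE mem_cat.
  by apply/negP => /andP[/orP[/pL /negPf->|/qL/andP[/negPf->]]].
move=> z; apply: leq_trans (outdegU _ _ _) _.
apply: leq_trans (leq_add (leqnn _) (outdegU _ _ _)) _.
have := outdeg_steps z (_ : uniq (x :: p)); rewrite /= xp up => /(_ isT).
have := outdeg_steps z (_ : uniq (y :: q)); rewrite /= yq uq => /(_ isT).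
move=> hq hp; rewrite addnA addnC leq_add2l (leq_trans (leq_add hq hp)) //.
have: ~~ ((z \in y :: q) && (z \in x :: p)).
  rewrite !inE; apply/negP => /andP[/orP[/eqP->|zq] /orP[/eqP zx|zp]].
  - by rewrite zx eqxx in xy.
  - by move: (kxN _ ky); rewrite sp1.
  - have /andP[zL _] := qL _ zq; move: kx; rewrite -zx /known (negPf zL) orbF.
    by rewrite (subsetP ch2) // sq2.
  - by have /andP[_] := qL _ zq; rewrite sp1.
by rewrite !inE mem_cat; case: (z == x); case: (z == y); case: (z \in p); case: (z \in q).
Qed.

(** Both halves have exactly [h] vertices, so the size of every gadget is known beforehand. *)
Definition linked h (a : V * V) (pq : seq V * seq V) :=
  [&& size pq.1 == h, size pq.2 == h, path e a.1 pq.1, path e a.2 pq.2 &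
      e (last a.1 pq.1) (last a.2 pq.2)].

Definition link_verts (lk : seq (seq V * seq V)) := flatten [seq pq.1 ++ pq.2 | pq <- lk].

(** The outdegree bound in the conclusion is what allows a later family of links to start at
    vertices of an earlier one. *)
Lemma extendable_links h L (prs : seq (V * V)) : extendable L -> rooted L ->
  uniq (unzip1 prs ++ unzip2 prs) ->
  (forall x, x \in unzip1 prs ++ unzip2 prs -> known L x && (outdeg L x <= 1)) ->
  m <= 2 ^ h -> #|L| + 2 * h * size prs + 7 * m + 2 ^ h.+2 <= #|R| ->
  exists (lk : seq (seq V * seq V)) L',
    [/\ all2 (linked h) prs lk, uniq (link_verts lk), extendable L' /\ rooted L',
      children L' = [set z in link_verts lk] :|: children L &
      [disjoint [set z in link_verts lk] & children L] /\
      forall z, outdeg L' z <= outdeg L z +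
        ((z \in unzip1 prs ++ unzip2 prs) + (z \in link_verts lk))].
Proof.
move=> + + + + mh; elim: prs L => [|[x y] prs IHp] L extL rL uprs kprs cL.
  exists [::], L; split=> //; first by apply/setP=> z; rewrite !inE.
  split; first by rewrite -setI_eq0; apply/eqP/setP=> z; rewrite !inE.
  by move=> z; rewrite addn0.
set E := unzip1 prs ++ unzip2 prs in IHp *.
have pE : perm_eq (unzip1 ((x, y) :: prs) ++ unzip2 ((x, y) :: prs)) [:: x, y & E].
  by rewrite /= perm_cons (perm_catCA (unzip1 prs) [:: y]).
rewrite (perm_uniq pE) /= inE negb_or in uprs.
have {kprs} kprs z : z \in [:: x, y & E] -> known L z && (outdeg L z <= 1).
  by rewrite -(seq.perm_mem pE); apply: kprs.
case/andP: uprs => /andP[xy xE] /andP[yE uE].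
have /andP[kx dx] := kprs x (mem_head _ _).
have /andP[ky dy] : known L y && (outdeg L y <= 1) by apply: kprs; rewrite !inE eqxx orbT.
have cL0 : #|L| + 7 * m + 2 ^ h.+2 <= #|R|.
  by apply: leq_trans cL; rewrite !leq_add2r leq_addr.
have [p [q [L1 [[sp sq pp pq epq] upq [ext1 r1] ch1 [dis1 deg1]]]]] :=
  extendable_connect extL rL kx ky xy dx dy mh cL0.
have cch L0 : extendable L0 -> #|children L0| = #|L0|.
  by case=> inj _ _; rewrite card_in_imset.
have cL1 : #|L1| = 2 * h + #|L|.
  rewrite -!cch // ch1 cardsU disjoint_setI0 // cards0 subn0 cardsE.
  by rewrite (card_uniqP upq) size_cat sp sq mul2n addnn.
have knew z : known L z -> z \notin p ++ q.
  case/orP=> kz; last by apply/negP => zp; have := disjointFl dis1 kz; rewrite inE zp.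
  apply: contra kz => zp; apply: (subsetP (children_sub ext1)).
  by rewrite ch1 !inE zp.
have [|z zE||lk [L' [alk ulk [ext' r'] ch' [dis' deg']]]] := IHp L1 ext1 r1.
- by [].
- have /andP[kz dz] : known L z && (outdeg L z <= 1).
    by apply: kprs; rewrite !inE zE !orbT.
  rewrite /known ch1 !inE; apply/andP; split.
    by case/orP: kz => ->; rewrite ?orbT.
  apply: leq_trans (deg1 z) _; rewrite 2!in_cons (negPf (knew _ kz)) orbF.
  case: eqP => [zx|_]; first by rewrite -zx zE in xE.
  by case: eqP => [zy|_]; [rewrite -zy zE in yE | rewrite addn0].
- by rewrite cL1; apply: leq_trans cL; rewrite !leq_add2r /= mulnS addnA [2 * h + _]addnC.
exists ((p, q) :: lk), L'; rewrite /link_verts /= -/(link_verts lk).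
split; rewrite ?alk ?andbT //.
- by rewrite /linked /= sp sq !eqxx pp pq epq.
- rewrite cat_uniq upq ulk andbT; apply/hasPn => z zl.
  by have := disjointFr dis' (_ : z \in [set z in link_verts lk]); rewrite ch1 !inE zl => /(_ isT)/norP[].
- by rewrite ch' ch1; apply/setP=> z; rewrite !inE !mem_cat; case: (z \in p); case: (z \in q); case: (z \in link_verts lk).
split.
  rewrite -setI_eq0; apply/eqP/setP=> z; rewrite in_set0 in_setI inE mem_cat.
  apply/negP => /andP[/orP[zp|zl] zL].
    by have := disjointFl dis1 zL; rewrite inE zp.
  by have := disjointFr dis' (_ : z \in [set z in link_verts lk]); rewrite ch1 !inE zl zL orbT => /(_ isT).
move=> z; apply: leq_trans (deg' z) _.
apply: leq_trans (leq_add (deg1 z) (leqnn _)) _.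
rewrite -addnA leq_add2l (seq.perm_mem pE) 4!in_cons [z \in (p ++ q) ++ _]mem_cat.
have [zpq|] := boolP (z \in p ++ q).
  have zE : z \notin E.
    apply: contraL zpq => zE; apply: knew.
    by have := kprs z; rewrite !inE zE !orbT => /(_ isT)/andP[].
  have zl : z \notin link_verts lk.
    apply/negP => zl; have := disjointFr dis' (_ : z \in [set z in link_verts lk]).
    by rewrite ch1 !inE zl zpq => /(_ isT).
  by rewrite (negPf zE) (negPf zl) !orbT /=; case: (_ || _).
rewrite orbF; case: eqP => [->|_]; first by rewrite (negPf xE).
by case: eqP => [->|_]; first by rewrite (negPf yE).
Qed.

(** This path of prescribed length absorbs the remainder of [n] modulo the number of layers. *)
Lemma extendable_pad r L x : extendable L -> rooted L -> known L x ->
  outdeg L x <= 2 -> #|L| + r + 7 * m <= #|R| ->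
  exists p L', [/\ size p = r /\ path e x p, uniq p, extendable L' /\ rooted L',
      children L' = [set z in p] :|: children L &
      [disjoint [set z in p] & children L] /\
      forall z, outdeg L' z <= outdeg L z + (z \in belast x p)].
Proof.
elim: r L x => [|r IHr] L x extL rL kx dx cL.
  exists [::], L; split=> //; first by apply/setP=> z; rewrite !inE.
  split; first by rewrite -setI_eq0; apply/eqP/setP=> z; rewrite !inE.
  by move=> z; rewrite addn0.
have [|y [yR yL exy ext1]] := extendable_add_leaf extL dx; first by clear -cL; lia.
pose L1 : {set V * V} := (x, y) |: L; rewrite -/L1 in ext1.
have ch1 : children L1 = y |: children L by rewrite childrenU1.
have r1 : rooted L1.
  apply: (rootedU rL kx) => a /set1P ->; exact: setU11.
have k1 : known L1 y by rewrite /known ch1 setU11 orbT.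
have d1 z : outdeg L1 z <= (x == z) + outdeg L z by apply: outdegU1.
have xy : x != y by apply: contraTneq kx => ->; rewrite /known yR.
have [||p [L' [[sp pp] up [ext' r'] ch' [dis' deg']]]] := IHr L1 y ext1 r1 k1.
- by apply: leq_trans (d1 y) _; rewrite (negPf xy) (outdeg_fresh rL).
- by have : #|L1| <= #|L|.+1 := card_setU1_le _ _; clear -cL; lia.
have np z : z \in p -> (z != y) && (z \notin children L).
  by move=> zp; have := disjointFr dis' (_ : z \in [set z in p]); rewrite ch1 !inE zp => /(_ isT)/norP[-> ->].
exists (y :: p), L'; split=> //.
- by rewrite /= sp exy.
- by rewrite /= up andbT; apply/negP => /np; rewrite eqxx.
- by rewrite ch' ch1; apply/setP=> z; rewrite !inE orbCA orbA.
split.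
  rewrite -setI_eq0; apply/eqP/setP=> z; rewrite in_set0 in_setI inE in_cons.
  apply/negP => /andP[/orP[/eqP->|/np/andP[_ /negPf->//]]]; exact/negP.
move=> z; apply: leq_trans (deg' z) _; rewrite /= in_cons eq_sym.
apply: leq_trans (leq_add (d1 z) (leqnn _)) _; rewrite addnAC addnC leq_add2l.
case: eqP => [<-|//]; rewrite [x \in _](_ : _ = false) //.
apply/negP => /mem_belast; rewrite in_cons (negPf xy) /= => xp.
have /andP[_ xL] := np _ xp; move: kx; rewrite /known (negPf xL) orbF => /negP; apply.
by apply: (subsetP (children_sub ext')); rewrite ch' !inE xp.
Qed.

End Linking.

(** * Switch gadgets *)

Section Ladder.
Variables (V : finType) (e : rel V).
Hypothesis e_sym : symmetric e.
Implicit Types (x y u w c : V) (p q : seq V).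

Lemma path_rev x p : path e x p -> path e (last x p) (rev (belast x p)).
Proof. by rewrite rev_path (eq_path (e' := e)) // => y z; rewrite e_sym. Qed.

Definition rung (xp : (V * V) * (seq V * seq V)) : seq V :=
  (xp.1.1 :: xp.2.1) ++ rev (xp.1.2 :: xp.2.2).

(* The rungs of a ladder traversed alternately in the two directions. *)
Fixpoint zigzag (flip : bool) (Bs : seq (seq V)) : seq V :=
  if Bs is B :: Bs' then (if flip then rev B else B) ++ zigzag (~~ flip) Bs' else [::].

Lemma size_zigzag flip Bs : size (zigzag flip Bs) = size (flatten Bs).
Proof.
elim: Bs flip => // B Bs IH flip; rewrite /= !size_cat IH.
by case: flip; rewrite ?size_rev.
Qed.

Lemma mem_zigzag flip Bs x : (x \in zigzag flip Bs) = (x \in flatten Bs).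
Proof.
elim: Bs flip => // B Bs IH flip; rewrite /= !mem_cat IH.
by case: flip; rewrite ?mem_rev.
Qed.

Lemma rung_path h x y p q : linked e h (x, y) (p, q) -> path e x (p ++ rev (y :: q)).
Proof.
case/and5P => /= _ _ pp pq epq; rewrite cat_path pp lastI rev_rcons /= epq.
exact: path_rev.
Qed.

Lemma rev_rung x y p q : rev (rung ((x, y), (p, q))) = rung ((y, x), (q, p)).
Proof. by rewrite /rung rev_cat revK. Qed.

Lemma linkedC h x y p q : linked e h (x, y) (p, q) = linked e h (y, x) (q, p).
Proof. by rewrite /linked /= [e (last y q) _]e_sym andbCA; congr (_ && _); congr (_ && _); rewrite andbCA. Qed.

(** The two rails of the ladder start at [u] and [w] and both end at [c]. Each rung changes the
    rail, and since the rails meet at [c] the parity of the number of rungs does not matter. *)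
Lemma zigzag_path h flip u w c (rs : seq ((V * V) * (seq V * seq V))) :
  all (fun r => linked e h r.1 r.2) rs ->
  path e u (rcons [seq r.1.1 | r <- rs] c) ->
  path e w (rcons [seq r.1.2 | r <- rs] c) ->
  path e (if flip then w else u) (rcons (zigzag flip (map rung rs)) c).
Proof.
elim: rs flip u w => [|[[x y] [p q]] rs IH] flip u w; first by case: flip.
move=> /= /andP[lk lks] /andP[ux px] /andP[wy py].
rewrite rcons_cat cat_path; case: flip.
  have lk2 := lk; rewrite linkedC in lk2.
  rewrite rev_rung /rung /= wy (rung_path lk2) last_cat rev_cons last_rcons.
  exact: IH false x y lks px py.
rewrite /rung /= ux (rung_path lk) last_cat rev_cons last_rcons /=.
exact: IH true x y lks px py.
Qed.

End Ladder.

Section FlattenCycle.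
Variables (V : eqType) (e : rel V) (T : Type) (pi : T -> T) (start : T -> V) (tail : T -> seq V).
Hypothesis tailP : forall x, path e (start x) (rcons (tail x) (start (pi x))).

Lemma flatten_path N x :
  path e (start x) (rcons (tail x ++ flatten [seq start y :: tail y | y <- traject pi (pi x) N])
                         (start (iter N.+1 pi x))).
Proof.
elim: N x => [|N IH] x; first by rewrite /= cats0.
rewrite iterSr [traject _ _ _]/= map_cons /= rcons_cat cat_path.
have := tailP x; rewrite rcons_path => /andP[-> etx] /=; rewrite etx.
exact: IH (pi x).
Qed.

Lemma flatten_cycle N x : iter N.+1 pi x = x ->
  path.cycle e (flatten [seq start y :: tail y | y <- traject pi x N.+1]).
Proof. by move=> Nx; have := flatten_path N x; rewrite Nx. Qed.
End FlattenCycle.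

Lemma next_inj k : injective (fun j : 'I_k.+1 => inord (j.+1 %% k.+1) : 'I_k.+1).
Proof.
move=> j j' E; apply/val_inj; have := congr1 val E; rewrite /= !inordK ?ltn_pmod // => E'.
have [jk j'k] := (ltn_ord j, ltn_ord j').
have md (x : nat) : x < k.+1 -> x.+1 %% k.+1 = if x == k then 0 else x.+1.
  by case: eqP => [->|xk xlt]; rewrite ?modnn // modn_small; lia.
by move: E'; rewrite !md //; case: eqP; case: eqP; lia.
Qed.

(** * Closing the strands of all gadgets into one cycle *)

Section Assembly.
Variables (V : finType) (e : rel V) (k : nat).
Hypothesis e_sym : symmetric e.
(* Gadget j joins its top pair a j, b j to c j by a ladder, so that either
   a j ~> c j or b j ~> c j can be routed through all of its rungs; i j is adjacent
   to both a j and b j, and receives whichever of them the zigzag does not use. *)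
Variables (i a b c : 'I_k.+1 -> V) (Bs : 'I_k.+1 -> seq (seq V)).
Variables (outa outb : 'I_k.+1 -> seq V) (rho : 'I_k.+1 -> 'I_k.+1).
Local Notation T := ('I_k.+1 * bool)%type.
Local Notation next j := (inord (j.+1 %% k.+1) : 'I_k.+1).
Hypotheses (ia : forall j, e (i j) (a j)) (ib : forall j, e (i j) (b j)).
Hypothesis zig : forall j, path e (a j) (rcons (zigzag false (Bs j)) (c j)).
Hypothesis zag : forall j, path e (b j) (rcons (zigzag true (Bs j)) (c j)).
Hypothesis rho_inj : injective rho.
Hypothesis outaP : forall j, path e (a j) (rcons (outa j) (i (rho j))).
Hypothesis outbP : forall j, path e (b j) (rcons (outb j) (c (next j))).

(** Entrance [true] of gadget [j] is [i j] and entrance [false] is [c j]; exit [true] is [outa j]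
    and exit [false] is [outb j]. The connection by [outb] to the next gadget is the chain that
    [exists_single_orbit] requires, while [rho] may be any injection. *)
Let start (x : T) := if x.2 then i x.1 else c x.1.
Let nxt (x : T) : T := if x.2 then (rho x.1, true) else (next x.1, false).

Let nxt_inj : injective nxt.
Proof.
move=> [j []] [j' []] //= [].
  by move=> /rho_inj ->.
by move=> E; congr (_, _); apply: next_inj E.
Qed.

Let pnxt := perm nxt_inj.

(** The strand entering at [c j] traverses all rungs backwards, up to [a j] or [b j] according to
    [s j]. The strand entering at [i j] steps directly to the other one of these two vertices. *)
Let tail (s : 'I_k.+1 -> bool) (x : T) : seq V :=
  let j := x.1 in
  if x.2 then (if s j then b j :: outb j else a j :: outa j)
  else if s j then rev (a j :: zigzag false (Bs j)) ++ outa j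
       else rev (b j :: zigzag true (Bs j)) ++ outb j.

Let rev_strand x y p : path e x (rcons p y) -> path e y (rev (x :: p)).
Proof. by move/(path_rev e_sym); rewrite last_rcons belast_rcons. Qed.

Let tailP (s : {ffun 'I_k.+1 -> bool}) x :
  path e (start x) (rcons (tail s x) (start (state_perm pnxt s x))).
Proof.
rewrite state_permE permE /start /nxt /tail; case: x => j [] /=.
  by case: (s j) => /=; rewrite ?ia ?ib ?outaP ?outbP.
case: (s j) => /=; rewrite rcons_cat cat_path rev_strand //= rev_cons last_rcons;
  [exact: outaP|exact: outbP].
Qed.

(** The single orbit lists every strand once, and concatenating the strands closes up. Total length
    and coverage are recorded instead of distinctness, which will follow from them by counting. *)
Lemma assemble_cycle : exists S : seq V, [/\ path.cycle e S,
  size S = \sum_j (4 + size (flatten (Bs j)) + size (outa j) + size (outb j)) &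
  forall j v, v \in [:: i j; a j; b j; c j] ++ flatten (Bs j) ++ outa j ++ outb j -> v \in S].
Proof.
have [|s all_s] := @exists_single_orbit k pnxt; first by move=> j; rewrite permE.
pose pi := state_perm pnxt s; pose x0 : T := (ord0, true).
pose N := #|porbit pi x0|.
have N_gt0 : 0 < N by rewrite lt0n card_porbit_neq0.
pose tr := traject pi x0 N.
have mem_tr x : x \in tr by rewrite /tr /N -porbit_traject all_s.
have perm_tr : perm_eq tr (index_enum T).
  apply: uniq_perm; rewrite ?uniq_traject_porbit ?index_enum_uniq //.
  by move=> x; rewrite mem_tr mem_index_enum.
exists (flatten [seq start y :: tail s y | y <- tr]); split.
- rewrite /tr -(prednK N_gt0); apply: flatten_cycle; first exact: tailP.
  by rewrite prednK // iter_porbit.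
- rewrite size_flatten /shape -map_comp sumnE big_map (perm_big _ perm_tr) /=.
  rewrite (eq_bigr (fun x : T => (fun j β => (size (tail s (j, β))).+1) x.1 x.2)); last by case.
  rewrite -(pair_bigA _ (fun j β => (size (tail s (j, β))).+1)) /=.
  apply: eq_bigr => j _; rewrite big_bool /tail /=; case: (s j) => /=;
  by rewrite rev_cons -cats1 !size_cat size_rev size_zigzag /=; lia.
move=> j v vj; apply/flattenP.
have in1 x : v \in start x :: tail s x -> exists2 t, t \in [seq start y :: tail s y | y <- tr] & v \in t.
  by move=> vx; exists (start x :: tail s x) => //; apply: map_f.
have : (v \in start (j, true) :: tail s (j, true)) || (v \in start (j, false) :: tail s (j, false)).
  move: vj; rewrite /start /tail /= !inE !mem_cat.
  case: (s j); rewrite rev_cons !inE !mem_cat ?mem_rcons !inE ?mem_rev !mem_zigzag;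
    do !case/orP=> [->|]; rewrite ?orbT // => ->; rewrite ?orbT //.
by case/orP=> /in1.
Qed.
End Assembly.

Lemma flatten_map_uniqP (I V : eqType) (f : I -> seq V) (s : seq I) : uniq (flatten (map f s)) ->
  {in s, forall i, uniq (f i)} /\
  {in s &, forall i j v, v \in f i -> v \in f j -> i = j}.
Proof.
elim: s => [|i s IH] //=; rewrite cat_uniq => /and3P[ui /hasPn dis us].
have [us1 us2] := IH us.
have nin j v : j \in s -> v \in f j -> v \notin f i.
  by move=> js vj; apply: dis; apply/flattenP; exists (f j) => //; apply: map_f.
split=> [j|j j']; rewrite inE => /predU1P[->//|js]; first exact: us1.
  rewrite inE => /predU1P[->//|j's] v vj vj'.
  by rewrite (negPf (nin j' v _ _)) in vj.
rewrite inE => /predU1P[->|j's] v vj vj'; last exact: us2 vj vj'.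
by rewrite (negPf (nin j v _ _)) in vj'.
Qed.

Section LinkFamily.
Variables (V : finType) (e : rel V) (R : {set V}) (m : nat).
Hypothesis joined : forall U T : {set V}, m <= #|U| -> m <= #|T| ->
  exists x y, [/\ x \in U, y \in T & e x y].
Hypothesis m_gt0 : 0 < m.

Lemma link_family (I : finType) (x y : I -> V) h L :
  extendable e R m L -> rooted R L -> injective x -> injective y ->
  (forall i j, x i != y j) ->
  (forall i, known R L (x i) && (outdeg L (x i) <= 1)) ->
  (forall i, known R L (y i) && (outdeg L (y i) <= 1)) ->
  m <= 2 ^ h -> #|L| + 2 * h * #|I| + 7 * m + 2 ^ h.+2 <= #|R| ->
  exists (P Q : I -> seq V) L',
  [/\ forall i, linked e h (x i, y i) (P i, Q i), extendable e R m L' /\ rooted R L',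
      #|L'| = #|L| + 2 * h * #|I|,
      children L' = children L :|: [set v | [exists i, v \in P i ++ Q i]] &
  [/\ forall i, uniq (P i ++ Q i),
      forall i j v, v \in P i ++ Q i -> v \in P j ++ Q j -> i = j,
      forall i v, v \in P i ++ Q i -> v \notin children L &
      forall z, outdeg L' z <= outdeg L z +
        ([exists i, (z == x i) || (z == y i)] + [exists i, z \in P i ++ Q i])]].
Proof.
move=> extL rL xI yI xy kx ky mh cL.
pose prs := [seq (x i, y i) | i <- enum I].
have e1 : unzip1 prs = [seq x i | i <- enum I] by rewrite /unzip1 -map_comp.
have e2 : unzip2 prs = [seq y i | i <- enum I] by rewrite /unzip2 -map_comp.
have mem12 z : (z \in unzip1 prs ++ unzip2 prs) = [exists i, (z == x i) || (z == y i)].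
  rewrite mem_cat e1 e2; apply/orP/existsP.
    by case=> /mapP[i _ ->]; exists i; rewrite eqxx ?orbT.
  by case=> i /orP[/eqP->|/eqP->]; [left|right]; rewrite map_f ?mem_enum.
have [|z||] := @extendable_links _ e R m joined m_gt0 h L prs extL rL _ _ mh.
- rewrite e1 e2 cat_uniq; apply/and3P; split.
  + by rewrite map_inj_uniq ?enum_uniq.
  + by apply/hasPn => _ /mapP[i _ ->]; apply/mapP => -[j _ /eqP]; rewrite eq_sym (negPf (xy _ _)).
  + by rewrite map_inj_uniq ?enum_uniq.
- by rewrite mem12 => /existsP[i /orP[/eqP->|/eqP->]].
- by rewrite /prs size_map -cardE.
move=> lk [L' [alk ulk [ext' r'] ch' [dis deg]]].
have slk : size lk = size (enum I) by have := alk; rewrite all2E /prs size_map => /andP[/eqP->].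
pose f i := nth ([::], [::]) lk (index i (enum I)).
have lkE : lk = [seq f i | i <- enum I].
  apply: (@eq_from_nth _ ([::], [::])); first by rewrite size_map.
  move=> j jlt; have jI : j < size (enum I) by rewrite -slk.
  have [i0 _] : exists i : I, true.
    by move: jI; rewrite -cardE => /(leq_ltn_trans (leq0n _))/card_gt0P[i _]; exists i.
  by rewrite (nth_map i0) // /f index_uniq ?enum_uniq.
have lvE : link_verts lk = flatten [seq (f i).1 ++ (f i).2 | i <- enum I].
  by rewrite /link_verts {1}lkE -map_comp.
have mlv z : (z \in link_verts lk) = [exists i, z \in (f i).1 ++ (f i).2].
  rewrite lvE; apply/flatten_mapP/existsP => [[i _ zi]|[i zi]]; first by exists i.
  by exists i; rewrite ?mem_enum.
have [u1 u2] := flatten_map_uniqP (eq_ind _ (fun s => uniq s) ulk _ lvE).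
exists (fun i => (f i).1), (fun i => (f i).2), L'; split=> //.
- move=> i; have := alk; rewrite lkE all2E => /andP[_].
  rewrite /prs zip_map all_map => /allP/(_ i); rewrite mem_enum => /(_ isT) /=.
  by case: (f i).
- have card_ch L0 : extendable e R m L0 -> #|children L0| = #|L0|.
    by case=> inj _ _; rewrite card_in_imset.
  rewrite -!card_ch // ch' cardsU disjoint_setI0 // cards0 subn0 cardsE (card_uniqP ulk).
  rewrite lvE size_flatten /shape -map_comp addnC; congr (_ + _).
  rewrite sumnE big_map big_enum /= (eq_bigr (fun=> 2 * h)) => [|i _].
    by rewrite sum_nat_const mulnC.
  have := alk; rewrite lkE all2E => /andP[_].
  rewrite /prs zip_map all_map => /allP/(_ i); rewrite mem_enum => /(_ isT) /=.
  by rewrite size_cat => /and3P[/eqP -> /eqP -> _]; rewrite mul2n addnn.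
- by rewrite ch' setUC; congr (_ :|: _); apply/setP=> z; rewrite !inE mlv.
split.
- by move=> i; apply: u1; rewrite mem_enum.
- by move=> i j v; apply: u2; rewrite mem_enum.
- move=> i v vi; have := disjointFr dis (_ : v \in [set z in link_verts lk]).
  by rewrite inE mlv => -> //; apply/existsP; exists i.
- by move=> z; rewrite -mlv -mem12.
Qed.

End LinkFamily.

(** * Disjoint paths through layers of equal size *)

Section LayerPaths.
Variables (V : finType) (e : rel V) (K : nat) (good : {set V} -> Prop).
Hypothesis matching : forall W W' : {set V}, good W -> good W' ->
  exists2 f : V -> V, {in W &, injective f} & forall x, x \in W -> f x \in W' /\ e x (f x).
Hypothesis card_good : forall W, good W -> #|W| = K.

(** The matchings are composed. As all layers have size [K], an injection from one layer to the next
    is onto, so the paths cover every layer. *)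
Lemma layer_paths (A : {set V}) (Ws : seq {set V}) : good A ->
  (forall W, W \in Ws -> good W) ->
  exists F : V -> seq V, [/\ forall x, x \in A -> size (F x) = size Ws,
    forall x, x \in A -> path e x (F x),
    forall x, x \in A -> last x (F x) \in last A Ws,
    {in A &, injective (fun x => last x (F x))} &
    forall W w, W \in Ws -> w \in W -> exists2 x, x \in A & w \in F x].
Proof.
elim: Ws A => [|W Ws IH] A gA gWs; first by exists (fun=> [::]); split.
have gW : good W by apply: gWs; rewrite mem_head.
have [f fI fP] := matching gA gW.
have [|F [sF pF lF iF cF]] := IH W gW.
  by move=> W' W's; apply: gWs; rewrite inE W's orbT.
have fW x : x \in A -> f x \in W by case/fP.
have onto w : w \in W -> exists2 x, x \in A & w = f x.
  move=> wW; suff /setP/(_ w) : f @: A = W by rewrite wW => /imsetP.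
  apply/eqP; rewrite eqEcard card_in_imset // !card_good // leqnn andbT.
  by apply/subsetP=> _ /imsetP[x xA ->]; apply: fW.
exists (fun x => f x :: F (f x)); split=> /= [x xA|x xA|x xA|x y xA yA /=|W' w].
- by rewrite sF ?fW.
- by case: (fP x xA) => fx ->; apply: pF.
- by rewrite lF ?fW.
- by move/iF => /(_ (fW x xA) (fW y yA))/fI; apply.
rewrite inE => /predU1P[-> /onto[x xA ->]|W's wW'].
  by exists x; rewrite ?mem_head.
have [y /onto[x xA ->] wy] := cF W' w W's wW'.
by exists x; rewrite // inE wy orbT.
Qed.

End LayerPaths.

Lemma index_set (V : finType) (A : {set V}) k : #|A| = k.+1 ->
  exists a : 'I_k.+1 -> V, injective a /\ A = [set a j | j : 'I_k.+1].
Proof.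
move=> cA; have /card_gt0P[x0 _] : 0 < #|A| by rewrite cA.
pose a (j : 'I_k.+1) := nth x0 (enum A) j.
have sz : size (enum A) = k.+1 by rewrite -cardE.
have aI : injective a.
  by move=> j j' /eqP; rewrite nth_uniq ?enum_uniq ?sz // => /eqP/val_inj.
exists a; split=> //; apply/eqP; rewrite eq_sym eqEcard card_imset // card_ord cA leqnn andbT.
by apply/subsetP=> _ /imsetP[j _ ->]; rewrite -mem_enum mem_nth ?sz.
Qed.

(** * Construction of the switch gadgets inside the reserve *)

Section Network.
Variables (V : finType) (e : rel V) (A I P : {set V}) (m k h0 r : nat) (f : V -> V).
Local Notation K := k.+1.
Local Notation h := h0.+1.
Local Notation next j := (inord (j.+1 %% k.+1) : 'I_k.+1).
Hypothesis e_sym : symmetric e.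
Hypothesis joined : forall U T : {set V}, m <= #|U| -> m <= #|T| ->
  exists x y, [/\ x \in U, y \in T & e x y].
Hypotheses (m_gt0 : 0 < m) (cA : #|A| = K) (cI : #|I| = K).
Hypotheses (dAI : [disjoint A & I]) (dP : [disjoint P & A :|: I]).
Hypotheses (f_inj : {in A &, injective f}) (fP : forall x, x \in A -> f x \in I /\ e x (f x)).
Hypothesis ext0 : extendable e P m set0.
Hypotheses (mh : m <= 2 ^ h) (room : 2 * h * (K * h.+1) + r + 7 * m + 2 ^ h.+2 <= #|P|).

(** Three rounds of links are made in [P]: one closes each matching edge between [a j] and [i j] to
    a cycle, one draws the rungs across it, and one connects the [b j] side to [c] of the next
    gadget. *)
Lemma gadget_network : exists (i a b c : 'I_K -> V) (Bs : 'I_K -> seq (seq V))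
    (outb : 'I_K -> seq V) (T : {set V}),
  [/\ injective a /\ injective i, A = [set a j | j : 'I_K], I = [set i j | j : 'I_K],
     T \subset P & #|T| = 2 * h * (K * h.+1) + r] /\
  [/\ forall j, e (i j) (a j) /\ e (i j) (b j),
     forall j, path e (a j) (rcons (zigzag false (Bs j)) (c j)) /\
               path e (b j) (rcons (zigzag true (Bs j)) (c j)),
     forall j, path e (b j) (rcons (outb j) (c (next j))),
     (forall j, size (flatten (Bs j)) = h0 * (2 * h + 2)) /\
       \sum_j size (outb j) = K * (2 * h) + r &
     forall v, v \in T -> exists j, v \in [:: b j; c j] ++ flatten (Bs j) ++ outb j].
Proof.
have [a [a_inj aE]] := index_set cA.
have aA j : a j \in A by rewrite aE imset_f.
pose i j := f (a j).
have iI j : i j \in I by case: (fP (aA j)).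
have ai j : e (a j) (i j) by case: (fP (aA j)).
have i_inj : injective i by move=> j j' E; apply: a_inj; apply: f_inj E.
have iE : I = [set i j | j : 'I_K].
  apply/eqP; rewrite eq_sym eqEcard card_imset // card_ord cI leqnn andbT.
  by apply/subsetP=> _ /imsetP[j _ ->].
have aP j : a j \notin P by apply/negP => aP; have := disjointFr dP aP; rewrite inE aA.
have iP j : i j \notin P by apply/negP => iP; have := disjointFr dP iP; rewrite inE iI orbT.
have ane j j' : a j != i j'.
  by apply/eqP => E; have := disjointFr dAI (aA j); rewrite E iI.
have root0 : rooted P set0 by move=> z; rewrite inE.
have out0 z : outdeg (set0 : {set V * V}) z = 0.
  by apply/eqP; rewrite cards_eq0; apply/eqP/setP=> z'; rewrite !inE.
have kn0 z : z \notin P -> known P set0 z && (outdeg set0 z <= 1).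
  by move=> zP; rewrite /known zP out0.
have room1 : #|(set0 : {set V * V})| + 2 * h * #|'I_K| + 7 * m + 2 ^ h.+2 <= #|P|.
  apply: leq_trans room; rewrite cards0 card_ord add0n !leq_add2r.
  by apply: leq_trans (leq_addr _ _); rewrite leq_mul2l leq_pmulr ?orbT.
have [P1 [Q1 [L1 [lk1 [ext1 r1] cL1 ch1 [u1 inj1 new1 deg1]]]]] :=
  link_family joined m_gt0 ext0 root0 a_inj i_inj ane
    (fun j => kn0 _ (aP j)) (fun j => kn0 _ (iP j)) mh room1.
rewrite cards0 add0n card_ord in cL1.
have [x0 _] : exists x : V, true by exists (a ord0).
have sP1 j : size (P1 j) = h by have /and5P[/eqP] := lk1 j.
have sQ1 j : size (Q1 j) = h by have /and5P[_ /eqP] := lk1 j.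
(* On the cycle through [a j], [P1 j], [Q1 j] and [i j], the vertex [c j] is the far end of [P1 j]
   and [b j] is the neighbour of [i j] in [Q1 j]. The other [h0] vertices of [P1 j] and of [Q1 j]
   are the feet of the rungs. *)
pose c j := nth x0 (P1 j) h0; pose b j := nth x0 (Q1 j) 0.
pose x (jt : 'I_K * 'I_h0) := nth x0 (P1 jt.1) jt.2.
pose y (jt : 'I_K * 'I_h0) := nth x0 (Q1 jt.1) jt.2.+1.
have Pin j t : t < h -> nth x0 (P1 j) t \in P1 j ++ Q1 j.
  by move=> th; rewrite mem_cat mem_nth ?sP1.
have Qin j t : t < h -> nth x0 (Q1 j) t \in P1 j ++ Q1 j.
  by move=> th; rewrite mem_cat mem_nth ?orbT ?sQ1.
have th0 (t : 'I_h0) : t < h by rewrite ltnS ltnW.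
have PP j t j' t' : t < h -> t' < h -> nth x0 (P1 j) t = nth x0 (P1 j') t' -> j = j' /\ t = t'.
  move=> th t'h E; have jj : j = j'.
    by apply: inj1 (Pin j t th) _; rewrite E Pin.
  split=> //; move: E (u1 j); rewrite jj cat_uniq => /eqP + /andP[uP _].
  by rewrite nth_uniq ?sP1 // => /eqP.
have QQ j t j' t' : t < h -> t' < h -> nth x0 (Q1 j) t = nth x0 (Q1 j') t' -> j = j' /\ t = t'.
  move=> th t'h E; have jj : j = j'.
    by apply: inj1 (Qin j t th) _; rewrite E Qin.
  split=> //; move: E (u1 j); rewrite jj cat_uniq => /eqP + /and3P[_ _ uQ].
  by rewrite nth_uniq ?sQ1 // => /eqP.
have PQ j t j' t' : t < h -> t' < h -> nth x0 (P1 j) t != nth x0 (Q1 j') t'.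
  move=> th t'h; apply/eqP => E; have jj : j = j'.
    by apply: inj1 (Pin j t th) _; rewrite E Qin.
  move: (u1 j); rewrite cat_uniq => /and3P[_ /hasPn no _].
  by have := no (nth x0 (Q1 j') t'); rewrite jj mem_nth ?sQ1 // -E jj /= mem_nth ?sP1 // => /(_ isT).
have ch1P : children L1 \subset P := children_sub ext1.
have old1 v j : v \in P1 j ++ Q1 j -> known P L1 v && (outdeg L1 v <= 1).
  move=> vj; have vL1 : v \in children L1.
    by rewrite ch1 !inE; apply/orP; right; apply/existsP; exists j.
  rewrite /known vL1 orbT; apply: leq_trans (deg1 v) _; rewrite out0 add0n.
  case: existsP => [[j' /orP[/eqP vE|/eqP vE]]|_]; last by case: existsP.
    by have := aP j'; rewrite -vE (subsetP ch1P).
  by have := iP j'; rewrite -vE (subsetP ch1P).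
(* Each gadget needs one closing link, [h0] rungs and one connection, with [2 * h] vertices each. *)
have hK : K * h.+1 = K + K * h0 + K by lia.
have hK2 : 2 * h * (K * h.+1) = 2 * h * K + 2 * h * (K * h0) + 2 * h * K by rewrite hK !mulnDr.
have x_inj : injective x.
  move=> [j t] [j' t'] E; have [/= -> tt] := PP _ _ _ _ (th0 t) (th0 t') E.
  by congr (_, _); apply: val_inj.
have y_inj : injective y.
  move=> [j t] [j' t'] E; have [/= -> [tt]] := QQ _ _ _ _ (ltn_ord t : t.+1 < h) (ltn_ord t' : t'.+1 < h) E.
  by congr (_, _); apply: val_inj.
have xy jt jt' : x jt != y jt' by exact: PQ (th0 _) (ltn_ord jt'.2 : jt'.2.+1 < h).
have room2 : #|L1| + 2 * h * #|{: 'I_K * 'I_h0}| + 7 * m + 2 ^ h.+2 <= #|P|.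
  apply: leq_trans room; rewrite cL1 card_prod !card_ord !leq_add2r hK2.
  by rewrite -[X in _ <= X]addnA leq_addr.
have [P2 [Q2 [L2 [lk2 [ext2 r2] cL2 ch2 [u2 inj2 new2 deg2]]]]] :=
  link_family joined m_gt0 ext1 r1 x_inj y_inj xy
    (fun jt => old1 _ _ (Pin jt.1 jt.2 (th0 jt.2))) (fun jt => old1 _ _ (Qin jt.1 jt.2.+1 (ltn_ord jt.2))) mh room2.
rewrite card_prod !card_ord cL1 in cL2.
(* The vertices [b j] and [c j] are not feet of rungs, so the second round leaves their outdegree at
   most 1 and the third round can use them. *)
have fresh2 v : v \in children L1 -> (forall jt, v != x jt) -> (forall jt, v != y jt) ->
    outdeg L2 v <= outdeg L1 v.
  move=> vL1 vx vy; apply: leq_trans (deg2 v) _.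
  case: existsP => [[jt]|_]; first by rewrite (negPf (vx jt)) (negPf (vy jt)).
  by case: existsP => [[jt /new2]|_]; rewrite ?vL1 ?addn0.
have chL12 v : v \in children L1 -> v \in children L2 by rewrite ch2 inE => ->.
have Lin1 j v : v \in P1 j ++ Q1 j -> v \in children L1.
  by move=> vj; rewrite ch1 !inE; apply/orP; right; apply/existsP; exists j.
have cin j : c j \in P1 j ++ Q1 j by apply: Pin.
have bin j : b j \in P1 j ++ Q1 j by apply: Qin.
have c2 j : outdeg L2 (c j) <= 1.
  have /andP[_] := old1 _ _ (cin j); apply: leq_trans.
  apply: fresh2; first exact: Lin1 (cin j).
    move=> [j' t]; apply/eqP => E; have [_ /= ht] := PP _ _ _ _ (ltnSn h0) (th0 t) E.
    by have := ltn_ord t; rewrite -ht ltnn.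
  by move=> jt; exact: PQ (ltnSn h0) (ltn_ord jt.2 : jt.2.+1 < h).
have b2 j : outdeg L2 (b j) <= 1.
  have /andP[_] := old1 _ _ (bin j); apply: leq_trans.
  apply: fresh2; first exact: Lin1 (bin j).
    by move=> jt; rewrite eq_sym; exact: PQ (th0 _) (ltn0Sn h0).
  by move=> [j' t]; apply/eqP => E; have [] := QQ _ _ _ _ (ltn0Sn h0) (ltn_ord t : t.+1 < h) E.
have known2 j v : v \in P1 j ++ Q1 j -> known P L2 v.
  by move=> vj; rewrite /known (chL12 _ (Lin1 _ _ vj)) orbT.
have room3 : #|L2| + r + 7 * m <= #|P|.
  apply: leq_trans room; rewrite cL2 hK2.
  by move: (2 * h * K) (2 * h * _) (2 ^ _) => u v w; clear; lia.
have [pad [L3 [[spad ppad] upad [ext3 r3] ch3 [dis3 deg3]]]] :=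
  extendable_pad joined m_gt0 ext2 r2 (known2 _ _ (bin ord0)) (leqW (b2 ord0)) room3.
have cL3 : #|L3| = 2 * h * K + 2 * h * (K * h0) + r.
  have card_ch L0 : extendable e P m L0 -> #|children L0| = #|L0|.
    by case=> inj _ _; rewrite card_in_imset.
  rewrite -card_ch // ch3 cardsU disjoint_setI0 // cards0 subn0 card_ch // cL2.
  by rewrite cardsE (card_uniqP upad) spad addnC.
have padN v : v \in pad -> v \notin children L2.
  by move=> vp; have := disjointFr dis3 (_ : v \in [set z in pad]); rewrite inE => ->.
have bpad j : b j \notin pad.
  by apply/negP => /padN; rewrite (chL12 _ (Lin1 _ _ (bin j))).
have cpad j : c j \notin pad.
  by apply/negP => /padN; rewrite (chL12 _ (Lin1 _ _ (cin j))).
(* All of the padding goes into the connection leaving gadget [ord0], whose link then starts at the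
   end of the pad. With an empty pad it starts at [b ord0] as for the others. *)
pose pads (j : 'I_K) := if j == ord0 then pad else [::].
pose x' j := last (b j) (pads j); pose y' (j : 'I_K) := c (next j).
have b_inj : injective b by move=> j j' E; have [] := QQ _ _ _ _ (ltn0Sn h0) (ltn0Sn h0) E.
have c_inj : injective c by move=> j j' E; have [] := PP _ _ _ _ (ltnSn h0) (ltnSn h0) E.
have y'_inj : injective y' by move=> j j' /c_inj/next_inj.
have x'in j : x' j = b j \/ j = ord0 /\ x' j \in pad.
  rewrite /x' /pads; case: eqP => [->|_]; last by left.
  case: (pad) => [|z s]; [by left | by right; split; rewrite /= ?mem_last].
have x'_inj : injective x'.
  move=> j j'; case: (x'in j) => [->|[-> xp]]; case: (x'in j') => [->|[-> xp']] //.
  - exact: b_inj.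
  - by move=> E; have := bpad j; rewrite E xp'.
  - by move=> E; have := bpad j'; rewrite -E xp.
have xy' j j' : x' j != y' j'.
  case: (x'in j) => [->|[_ xp]]; first by rewrite eq_sym; exact: PQ (ltnSn h0) (ltn0Sn h0).
  by apply: contraTneq xp => ->; apply: cpad.
have known3 v : known P L2 v -> known P L3 v.
  by rewrite /known ch3 inE => /orP[->|->]; rewrite ?orbT.
have kx' j : known P L3 (x' j) && (outdeg L3 (x' j) <= 1).
  have nb0 : b j != b ord0 -> b j \notin belast (b ord0) pad.
    by move=> bj; apply: contra (bpad j) => /mem_belast; rewrite inE (negPf bj).
  have [j0|j0] := eqVneq j ord0; last first.
    rewrite /x' /pads (negPf j0) /= known3 ?(known2 _ _ (bin j)) //.
    apply: leq_trans (deg3 _) _; rewrite (negPf (nb0 _)) ?addn0 //.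
    by apply: contra j0 => /eqP/b_inj->.
  rewrite /x' /pads j0 eqxx; case: (pad) (ch3) (padN) (upad) (deg3) (bpad) => [|z s] ch3' padN' upad' deg3' bpad'.
    rewrite /= known3 ?(known2 _ _ (bin ord0)) //.
    by apply: leq_trans (deg3' _) _; rewrite addn0.
  have zl : last (b ord0) (z :: s) \in z :: s by rewrite /= mem_last.
  rewrite /known ch3' !in_setU [_ \in [set _ in _]]inE zl !orbT /=.
  apply: leq_trans (deg3' _) _.
  have -> : outdeg L2 (last z s) = 0.
    apply: outdeg_fresh r2 _ _; last exact: padN'.
    by apply: (subsetP (children_sub ext3)); rewrite ch3' inE [_ \in [set _ in _]]inE zl.
  have : uniq (rcons (belast (b ord0) (z :: s)) (last (b ord0) (z :: s))).
    by rewrite -lastI cons_uniq bpad' upad'.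
  by rewrite rcons_uniq => /andP[/negPf /= ->].
have ky' j : known P L3 (y' j) && (outdeg L3 (y' j) <= 1).
  have nb : y' j \notin belast (b ord0) pad.
    apply/negP => /mem_belast; rewrite inE (negPf (cpad _)) orbF; apply/negP.
    exact: PQ (ltnSn h0) (ltn0Sn h0).
  rewrite known3 ?(known2 _ _ (cin _)) //=; apply: leq_trans (deg3 _) _.
  by rewrite (negPf nb) addn0 c2.
have room4 : #|L3| + 2 * h * #|'I_K| + 7 * m + 2 ^ h.+2 <= #|P|.
  apply: leq_trans room; rewrite cL3 card_ord !leq_add2r hK2.
  by rewrite [X in _ <= X]addnAC.
have [P3 [Q3 [L4 [lk3 [ext4 r4] cL4 ch4 [u3 inj3 new3 deg4]]]]] :=
  link_family joined m_gt0 ext3 r3 x'_inj y'_inj xy' kx' ky' mh room4.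
rewrite card_ord cL3 in cL4.
pose rs j := [seq ((x (j, t), y (j, t)), (P2 (j, t), Q2 (j, t))) | t <- enum 'I_h0].
pose Bs j := map (@rung V) (rs j).
pose outb j := pads j ++ P3 j ++ rev (Q3 j).
have nth_enum n (s : seq V) : n <= size s -> [seq nth x0 s (nat_of_ord t) | t <- enum 'I_n] = take n s.
  by move=> ns; rewrite -(map_nth_iota0 x0 ns) -val_enum_ord -map_comp.
have rs1 j : [seq r.1.1 | r <- rs j] = take h0 (P1 j).
  by rewrite -nth_enum ?sP1 // /rs -map_comp; apply: eq_map.
have P1E j : P1 j = rcons [seq r.1.1 | r <- rs j] (c j).
  by rewrite rs1 /c -take_nth ?sP1 // -(sP1 j) take_size.
have rs2 j : [seq r.1.2 | r <- rs j] = behead (Q1 j).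
  have sb : size (behead (Q1 j)) = h0 by rewrite size_behead sQ1.
  rewrite -[RHS]take_size sb -nth_enum ?sb // /rs -map_comp; apply: eq_map => t /=.
  by rewrite nth_behead.
have Q1E j : Q1 j = b j :: [seq r.1.2 | r <- rs j].
  by rewrite rs2 /b; case: (Q1 j) (sQ1 j).
exists i, a, b, c, Bs, outb, (children L4); split; split=> //.
- exact: children_sub ext4.
- have -> : #|children L4| = #|L4| by case: ext4 => inj _ _; rewrite card_in_imset.
  by rewrite cL4 hK2 addnAC.
- move=> j; rewrite e_sym; split=> //.
  by have /and5P[_ _ _] := lk1 j; rewrite Q1E => /= /andP[].
- move=> j; have /and5P[_ _ /= pP pQ eL] := lk1 j.
  have all_rs : all (fun r => linked e h r.1 r.2) (rs j).
    by apply/allP => _ /mapP[t _ ->]; apply: lk2.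
  have pa : path e (a j) (rcons [seq r.1.1 | r <- rs j] (c j)) by rewrite -P1E.
  have pb : path e (b j) (rcons [seq r.1.2 | r <- rs j] (c j)).
    move: pQ eL; rewrite Q1E /= => /andP[_ pQ]; rewrite rcons_path pQ /=.
    by rewrite P1E last_rcons e_sym.
  split; first exact: (zigzag_path e_sym false all_rs pa pb).
  exact: (zigzag_path e_sym true all_rs pa pb).
- move=> j; rewrite /outb !rcons_cat cat_path.
  have := rung_path e_sym (lk3 j); rewrite rev_cons -rcons_cat -/(x' j) => ->.
  by rewrite andbT /pads; case: eqP => [->|].
- split=> [j|].
    rewrite /Bs /rs size_flatten /shape -map_comp -map_comp sumnE big_map big_enum /=.
    rewrite (eq_bigr (fun=> 2 * h + 2)) => [|t _]; first by rewrite sum_nat_const card_ord.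
    have /and5P[/eqP /= s1 /eqP /= s2 _ _ _] := lk2 (j, t).
    by rewrite /rung size_cat size_rev /= s1 s2; lia.
  rewrite (eq_bigr (fun j => size (pads j) + 2 * h)) => [|j _].
    rewrite big_split /= sum_nat_const card_ord addnC; congr (_ + _).
    by rewrite (bigD1 ord0) //= big1 ?addn0 => [|j j0]; rewrite /pads ?eqxx // (negPf j0).
  have /and5P[/eqP /= s1 /eqP /= s2 _ _ _] := lk3 j.
  by rewrite /outb !size_cat size_rev s1 s2; lia.
move=> v; rewrite ch4 ch3 ch2 ch1 !in_setU => /orP[/orP[|/orP[/orP[|]|]]|].
- rewrite inE => vp; exists ord0; rewrite /outb /pads eqxx !mem_cat vp.
  by rewrite !orbT.
- by rewrite /children imset0 inE.
- rewrite inE => /existsP[j vj]; exists j; rewrite mem_cat.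
  have rsB (t : 'I_h0) w : w \in rung ((x (j, t), y (j, t)), (P2 (j, t), Q2 (j, t))) -> w \in flatten (Bs j).
    move=> wt; apply/flattenP; exists (rung ((x (j, t), y (j, t)), (P2 (j, t), Q2 (j, t)))) => //.
    by apply: map_f; apply: map_f; rewrite mem_enum.
  move: vj; rewrite mem_cat P1E Q1E mem_rcons !inE => /or3P[/orP[->|]|->|]; rewrite ?orbT //.
    rewrite /rs -map_comp => /mapP[t _ ->]; apply/orP; right; rewrite mem_cat (rsB t) //.
    by rewrite /rung /= mem_head.
  rewrite /rs -map_comp => /mapP[t _ ->]; apply/orP; right; rewrite mem_cat (rsB t) //.
  by rewrite /rung /= !inE mem_cat mem_rev mem_head !orbT.
- rewrite inE => /existsP[[j t] vj]; exists j.
  rewrite !mem_cat; apply/orP; right; apply/orP; left; apply/flattenP.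
  exists (rung ((x (j, t), y (j, t)), (P2 (j, t), Q2 (j, t)))).
    by apply: map_f; apply: map_f; rewrite mem_enum.
  by move: vj; rewrite /rung /= inE !mem_cat mem_rev inE => /orP[]->; rewrite !orbT.
rewrite inE => /existsP[j vj]; exists j.
by move: vj; rewrite /outb !mem_cat mem_rev => ->; rewrite !orbT.
Qed.
End Network.

Import Order.TTheory GRing.Theory Num.Theory.
Local Notation expR := sequences.expR.

(** * Random layers *)

Section SetSum.
Local Open Scope ring_scope.

Lemma sum_expr_card (R : comNzRingType) (V : finType) (x : R) :
  \sum_(U : {set V}) x ^+ #|U| = (1 + x) ^+ #|V|.
Proof.
rewrite -prodr_const -[1 + x]/(1 + x).
transitivity (\prod_(i : V) \sum_(b : bool) (if b then x else 1)).
  rewrite bigA_distr_bigA (reindex (fun f : {ffun V -> bool} => [set i | f i])).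
    apply: eq_bigr => f _; rewrite -big_mkcond /= -prodr_const.
    by apply: eq_bigl => i; rewrite inE.
  exists (fun A : {set V} => [ffun i => i \in A]) => [f|A] _.
    by apply/ffunP=> i; rewrite ffunE inE.
  by apply/setP=> i; rewrite inE ffunE.
by apply: eq_bigr => i _; rewrite big_bool addrC.
Qed.
End SetSum.

Section RandomLayers.
Local Open Scope ring_scope.
Variables (R : realType) (V : finType) (K l : nat) (v : 'I_K -> 'I_l.+1 -> V).
Hypothesis v_inj : forall g a g' a', v g a = v g' a' -> g = g' /\ a = a'.
Implicit Types (f : {ffun 'I_K -> 'I_l.+1}) (j : 'I_l.+1) (Y : {set V}).

(* The K x l.+1 grid v is cut into layers by shifting its g-th row by f g. *)
Definition layer f j := [set v g (j + f g) | g : 'I_K].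

Definition grid := [set v ga.1 ga.2 | ga : 'I_K * 'I_l.+1].

(** Valid for every [f]: shifting rows keeps layer sizes exact and layers disjoint. Randomness is
    needed only for the intersections with given sets. *)
Lemma card_layer f j : #|layer f j| = K.
Proof. by rewrite card_imset ?card_ord // => g g' /v_inj[]. Qed.

Lemma card_layerI f j Y : #|layer f j :&: Y| = (\sum_g (v g (j + f g)%R \in Y))%N.
Proof.
have -> : layer f j :&: Y = [set v g (j + f g) | g in [set g | v g (j + f g) \in Y]].
  apply/setP=> y; rewrite inE; apply/andP/imsetP.
    by case=> /imsetP[g _ ->] gY; exists g; rewrite ?inE.
  by case=> g; rewrite inE => gY ->; rewrite gY imset_f.
rewrite card_imset => [|g g' /v_inj[]//].
by rewrite -sum1dep_card big_mkcond /=; apply: eq_bigr => g _; case: (_ \in Y).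
Qed.

Lemma card_gridI Y : #|Y :&: grid| = (\sum_g \sum_a (v g a \in Y))%N.
Proof.
rewrite pair_big /=.
have -> : Y :&: grid = [set v ga.1 ga.2 | ga in [set ga | v ga.1 ga.2 \in Y]].
  apply/setP=> y; rewrite inE; apply/andP/imsetP.
    by case=> yY /imsetP[g _ E]; exists g; rewrite // inE -E.
  by case=> g; rewrite inE => gY ->; rewrite gY imset_f.
rewrite card_imset => [|[g a] [g' a'] /v_inj[/= -> ->]//].
by rewrite -sum1dep_card big_mkcond /=; apply: eq_bigr => g _; case: (_ \in Y).
Qed.

(** Counting over all [f] replaces probabilities. The rows are shifted independently, so the sum
    factorises; a row with a fraction p of its entries in [Y] contributes [1 + (t - 1) p], at most
    the exponential of [(t - 1) p]. *)
Lemma layer_moment j Y (t : R) : 0 <= t ->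
  \sum_f t ^+ #|layer f j :&: Y| <=
    l.+1%:R ^+ K * expR ((t - 1) * #|Y :&: grid|%:R / l.+1%:R).
Proof.
move=> t0; under eq_bigr => f _ do rewrite card_layerI -prodrXr.
rewrite -(bigA_distr_bigA (fun g a => t ^+ (v g (j + a) \in Y))) card_gridI.
have -> : l.+1%:R ^+ K = \prod_(g < K) l.+1%:R :> R by rewrite prodr_const card_ord.
have -> : (t - 1) * (\sum_g \sum_a (v g a \in Y))%:R / l.+1%:R
   = \sum_g ((t - 1) * (\sum_a (v g a \in Y))%:R / l.+1%:R).
  by rewrite natr_sum mulr_sumr mulr_suml.
rewrite expR_sum -big_split /=; apply: ler_prod => g _; apply/andP; split.
  by apply: sumr_ge0 => a _; apply: exprn_ge0.
have -> : \sum_a t ^+ (v g (j + a) \in Y) = \sum_a t ^+ (v g a \in Y).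
  by rewrite [RHS](reindex_inj (addrI j)).
have -> : \sum_a t ^+ (v g a \in Y) =
    l.+1%:R * (1 + (t - 1) * (\sum_a (v g a \in Y))%:R / l.+1%:R).
  rewrite mulrDr mulr1 mulrCA divff ?pnatr_eq0 // mulr1 natr_sum mulr_sumr.
  have -> : l.+1%:R = \sum_(a < l.+1) 1 :> R by rewrite sumr_const card_ord.
  rewrite -big_split /=.
  by apply: eq_bigr => a _; case: (_ \in _); rewrite /= ?expr1 ?expr0; ring.
by rewrite ler_wpM2l // expR_ge1Dx.
Qed.

(** Markov's inequality with [t = expR (1/2) <= 2]: the mean is at most [T / 4], so the exponent is
    at most [T / 4 - T / 2]. *)
Lemma upper_tail j Y (T : R) :
  4 * #|Y :&: grid|%:R <= l.+1%:R * T ->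
  #|[set f | T <= #|layer f j :&: Y|%:R]|%:R <= l.+1%:R ^+ K * expR (- (T / 4)).
Proof.
move=> hT; set bad := [set f | _].
have h2 : expR (2^-1) <= 2 :> R.
  rewrite -[leLHS]invrK -[leRHS]invrK lef_pV2 ?posrE ?invr_gt0 ?expR_gt0 //.
  by rewrite -expRN; apply: le_trans (expR_ge1Dx _); lra.
have : #|bad|%:R * expR (T / 2) <= l.+1%:R ^+ K * expR (T / 4).
  apply: le_trans (_ : \sum_f expR (2^-1) ^+ #|layer f j :&: Y| <= _).
    rewrite mulrC -sum1_card natr_sum mulr_sumr [leRHS](bigID (fun f => f \in bad)) /=.
    rewrite -[leLHS]addr0 lerD ?sumr_ge0 // => [|f _]; last by rewrite exprn_ge0 ?expR_ge0.
    apply: ler_sum => f; rewrite inE mulr1 -expRM_natr ler_expR => Tf; lra.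
  apply: le_trans (layer_moment _ _ (expR_ge0 _)) _.
  rewrite ler_wpM2l ?exprn_ge0 // ler_expR.
  rewrite ler_pdivrMr ?ltr0n //.
  have : (expR 2^-1 - 1) * #|Y :&: grid|%:R <= 1 * #|Y :&: grid|%:R :> R.
    by rewrite ler_wpM2r //; lra.
  lra.
rewrite -ler_pdivlMr ?expR_gt0 // -expRN -mulrA -expRD => /le_trans; apply.
by rewrite ler_wpM2l ?exprn_ge0 // ler_expR; lra.
Qed.

(** Markov's inequality with [t = expR (-1) <= 1/2]. With mean M, the moment is at most
    [expR (- M / 2)], and the threshold [M / 4] gives back only half of this exponent. *)
Lemma lower_tail j Y :
  #|[set f | (4 * l.+1 * #|layer f j :&: Y| <= #|Y :&: grid|)%N]|%:R <=
    l.+1%:R ^+ K * expR (- (#|Y :&: grid|%:R / (4 * l.+1%:R))) :> R.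
Proof.
set bad := [set f | _]; set M := #|Y :&: grid|; pose T : R := M%:R / (4 * l.+1%:R).
have h2 : expR (-1) <= 2^-1 :> R.
  rewrite expRN lef_pV2 ?posrE ?expR_gt0 //.
  by apply: le_trans (expR_ge1Dx _); lra.
have : #|bad|%:R * expR (- T) <= l.+1%:R ^+ K * expR (- (2 * T)).
  apply: le_trans (_ : \sum_f expR (-1) ^+ #|layer f j :&: Y| <= _).
    rewrite mulrC -sum1_card natr_sum mulr_sumr [leRHS](bigID (fun f => f \in bad)) /=.
    rewrite -[leLHS]addr0 lerD ?sumr_ge0 // => [|f _]; last by rewrite exprn_ge0 ?expR_ge0.
    apply: ler_sum => f; rewrite inE mulr1 -expRM_natr ler_expR => Tf.
    rewrite mulN1r lerN2 /T ler_pdivlMr ?mulr_gt0 ?ltr0n //.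
    by rewrite mulrC -!natrM ler_nat.
  apply: le_trans (layer_moment _ _ (expR_ge0 _)) _.
  rewrite ler_wpM2l ?exprn_ge0 // ler_expR -/M /T.
  have M0 : 0 <= M%:R :> R by [].
  have : (expR (-1) - 1) * M%:R <= - 2^-1 * M%:R :> R.
    by rewrite ler_wpM2r //; lra.
  rewrite ler_pdivrMr ?ltr0n // => /le_trans; apply.
  have -> : - (2 * (M%:R / (4 * l.+1%:R))) * l.+1%:R = - 2^-1 * M%:R :> R.
    by field; rewrite nat1r pnatr_eq0.
  exact: lexx.
rewrite -ler_pdivlMr ?expR_gt0 // -expRN -mulrA -expRD => /le_trans; apply.
by rewrite ler_wpM2l ?exprn_ge0 // ler_expR -/T; lra.
Qed.

End RandomLayers.

Lemma card_bigcup_le (I T : finType) (P : pred I) (A : I -> {set T}) :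
  #|\bigcup_(i | P i) A i| <= \sum_(i | P i) #|A i|.
Proof.
elim/big_rec2: _ => [|i S m _ le]; first by rewrite cards0.
by apply: leq_trans (leq_card_setU _ _) _; rewrite leq_add2l.
Qed.

(** * Union bound over admissible sets *)

Section UnionBound.
Local Open Scope ring_scope.
Variables (R : realType) (V : finType) (e : rel V) (c g q s K l k a : nat).
Variable v : 'I_K -> 'I_l.+1 -> V.
Local Notation n := #|V|.
Hypothesis v_inj : forall g a g' a', v g a = v g' a' -> g = g' /\ a = a'.
Hypotheses (ls : (l.+1 <= s)%N) (sl : (s <= 2 * l.+1)%N) (nK : (n <= 2 * K * s)%N).
Hypotheses (a_le : (a <= 16)%N) (c_ge : (91 <= c)%N) (g_ge : (64 * 64 <= g)%N).
Hypotheses (k_ge : (8 * s * n <= 2 ^ k)%N) (q_ge : (32 * 64 * s * k <= q)%N).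
Hypothesis grid_dense : forall U : {set V}, admissible e q U ->
  (#|nb e U| <= a * #|nb e U :&: grid v|)%N.
Hypothesis core_le : forall U : {set V}, (4 * #|nb e U| <= n)%N ->
  (c ^ 2 * #|core e q U| <= 16 * #|nb e U|)%N.
Implicit Types (f : {ffun 'I_K -> 'I_l.+1}) (j : 'I_l.+1) (U : {set V}).

Let good1 U j f := (#|nb e U| <= 4 * a * s * #|layer v f j :&: nb e U|)%N.
Let good2 U j f := (4 * #|nb e U| <= n)%N ==> (64 * s * #|core e q U :&: layer v f j| <= #|nb e U|)%N.
Let good3 U j f := (g * #|core e q U| < n)%N ==> (256 * #|core e q U :&: layer v f j| < K)%N.
Let good4 U j f := (g * #|~: nb e U| < n)%N ==> (256 * #|layer v f j :\: nb e U| < K)%N.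

(** A common bound for the failure of each clause. The constant 2048 comes from clauses 3 and 4:
    their threshold [K / 256] gives exponent [K / 1024], and [#|nb e U| <= n <= 2 K s]. With
    [q >= 2048 s k] this makes the bound at most [expR (- k)] to the power [#|U|]. *)
Let tail U : R := l.+1%:R ^+ K * expR (- (#|nb e U|%:R / (2048 * s%:R))).

Let s_gt0 : (0 : R) < s%:R.
Proof. by rewrite ltr0n (leq_trans _ ls). Qed.

Let tail_le U (T : R) : #|nb e U|%:R <= 2048 * s%:R * T ->
  l.+1%:R ^+ K * expR (- T) <= tail U.
Proof.
move=> hT; rewrite ler_wpM2l ?exprn_ge0 // ler_expR lerN2 ler_pdivrMr ?mulr_gt0 //.
by rewrite mulrC.
Qed.

Let bad1 U j : admissible e q U -> #|[set f | ~~ good1 U j f]|%:R <= tail U.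
Proof.
move=> aU; set Y := nb e U; have := grid_dense aU; rewrite -/Y => Ya.
apply: le_trans (_ : l.+1%:R ^+ K * expR (- (#|Y :&: grid v|%:R / (4 * l.+1%:R))) <= _).
  apply: le_trans (lower_tail R v_inj j Y); rewrite ler_nat.
  apply/subset_leq_card/subsetP => f; rewrite !inE /good1 -ltnNge -/Y => lt.
  have [a0|a0] := posnP a.
    by move: (leq_ltn_trans (leq0n _) (leq_trans lt Ya)); rewrite a0 mul0n.
  rewrite -(leq_pmul2l a0) (leq_trans _ Ya) //.
  apply: leq_trans (ltnW lt); rewrite mulnA (mulnA a) (mulnC a 4) leq_mul2r leq_mul2l ls.
  by rewrite !orbT.
apply: tail_le; rewrite mulrA ler_pdivlMr ?mulr_gt0 ?ltr0n // -/Y.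
have : (#|Y| * (4 * l.+1) <= 2048 * s * #|Y :&: grid v|)%N.
  apply: leq_trans (_ : a * #|Y :&: grid v| * (4 * s) <= _)%N.
    by rewrite leq_mul // leq_mul2l.
  have : (a * (#|Y :&: grid v| * s) <= 16 * (#|Y :&: grid v| * s))%N by rewrite leq_mul2r a_le orbT.
  by move: #|_ :&: _| => M; clear; lia.
by rewrite -(ler_nat R) !natrM.
Qed.

Let upper (Z : {set V}) U j (T : R) :
  4 * #|Z|%:R <= l.+1%:R * T -> #|nb e U|%:R <= 2048 * s%:R * (T / 4) ->
  #|[set f | T <= #|layer v f j :&: Z|%:R]|%:R <= tail U.
Proof.
move=> ZT YT; apply: le_trans (upper_tail v_inj _ _) (tail_le YT).
by apply: le_trans ZT; rewrite ler_wpM2l // ler_nat subset_leq_card // subsetIl.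
Qed.

Let nbK U : #|nb e U|%:R <= 2 * K%:R * s%:R :> R.
Proof. by rewrite -!natrM ler_nat (leq_trans (max_card _)). Qed.

Let tail_ge0 U : 0 <= tail U.
Proof. by rewrite mulr_ge0 ?exprn_ge0 ?expR_ge0. Qed.

Let bad2 U j : #|[set f | ~~ good2 U j f]|%:R <= tail U.
Proof.
have [Y4|Y4] := leqP (4 * #|nb e U|) n; last first.
  rewrite (_ : [set f | _] = set0) ?cards0 //.
  by apply/setP=> f; rewrite !inE /good2 leqNgt Y4.
pose T : R := #|nb e U|%:R / (64 * s%:R).
apply: le_trans (_ : #|[set f | T <= #|layer v f j :&: core e q U|%:R]|%:R <= _).
  rewrite ler_nat; apply/subset_leq_card/subsetP => f; rewrite !inE /good2 Y4 /= -ltnNge.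
  move=> lt; rewrite /T ler_pdivrMr ?mulr_gt0 // mulrC -!natrM ler_nat setIC.
  exact: ltnW.
(* Here [c >= 91] suffices, because [91 ^ 2 >= 16 * 512]: the core is 512 times smaller than
   [nb e U]. *)
have le1 : (256 * s * #|core e q U| <= l.+1 * #|nb e U|)%N.
  have cZ := core_le Y4.
  have c2 : (91 ^ 2 * #|core e q U| <= 16 * #|nb e U|)%N.
    by apply: leq_trans cZ; rewrite leq_mul2r leq_sqr c_ge orbT.
  have : (512 * #|core e q U| <= #|nb e U|)%N by move: c2; clear; lia.
  rewrite -(leq_pmul2l (ltn0Sn l)); apply: leq_trans.
  apply: leq_trans (_ : 256 * (2 * l.+1) * #|core e q U| <= _)%N.
    by rewrite leq_mul2r leq_mul2l sl !orbT.
  by move: #|core e q U| l.+1 => z L; clear; lia.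
apply: upper.
  rewrite /T mulrA ler_pdivlMr ?mulr_gt0 //.
  by move: le1; rewrite -(ler_nat R) !natrM; lra.
have -> : 2048 * s%:R * (T / 4) = 8 * #|nb e U|%:R.
  by rewrite /T; field; rewrite gt_eqF.
by rewrite ler_peMl ?ler1n.
Qed.

Let largeK (Z : {set V}) U j : (g * #|Z| < n)%N ->
  #|[set f | (K <= 256 * #|layer v f j :&: Z|)%N]|%:R <= tail U.
Proof.
move=> gZ; pose T : R := K%:R / 256.
apply: le_trans (_ : #|[set f | T <= #|layer v f j :&: Z|%:R]|%:R <= _).
  rewrite ler_nat; apply/subset_leq_card/subsetP => f; rewrite !inE.
  by move=> le; rewrite /T ler_pdivrMr // mulrC -natrM ler_nat.
(* Where [g >= 4096] is spent: the bounds [n <= 2 K s] and [s <= 2 l.+1] cost a factor 4, leaving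
   1024. *)
have le1 : (1024 * #|Z| <= l.+1 * K)%N.
  have : (64 * 64 * #|Z| <= 2 * K * (2 * l.+1))%N.
    apply: leq_trans (_ : 2 * K * s <= _)%N; last by rewrite leq_mul2l sl orbT.
    apply: leq_trans nK; apply: leq_trans (ltnW gZ); rewrite leq_mul2r g_ge.
    by rewrite orbT.
  by move: #|Z| l.+1 => z L; clear; lia.
apply: upper.
  rewrite /T mulrA ler_pdivlMr //.
  by move: le1; rewrite -(ler_nat R) !natrM; lra.
by apply: le_trans (nbK U) _; rewrite /T; lra.
Qed.

Let bad3 U j : #|[set f | ~~ good3 U j f]|%:R <= tail U.
Proof.
have [gZ|gZ] := ltnP (g * #|core e q U|) n; last first.
  rewrite (_ : [set f | _] = set0) ?cards0 //.
  by apply/setP=> f; rewrite !inE /good3 ltnNge gZ.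
apply: le_trans (largeK U j gZ); rewrite ler_nat.
apply/subset_leq_card/subsetP => f; rewrite !inE /good3 gZ /= -leqNgt.
by rewrite setIC.
Qed.

Let bad4 U j : #|[set f | ~~ good4 U j f]|%:R <= tail U.
Proof.
have [gZ|gZ] := ltnP (g * #|~: nb e U|) n; last first.
  rewrite (_ : [set f | _] = set0) ?cards0 //.
  by apply/setP=> f; rewrite !inE /good4 ltnNge gZ.
apply: le_trans (largeK U j gZ); rewrite ler_nat.
apply/subset_leq_card/subsetP => f; rewrite !inE /good4 gZ /= -leqNgt.
by rewrite setDE.
Qed.

Let good U j f := [&& good1 U j f, good2 U j f, good3 U j f & good4 U j f].

Let bad U j : admissible e q U ->
  #|[set f | ~~ good U j f]|%:R <= 4 * (l.+1%:R ^+ K * expR (- k%:R) ^+ #|U|) :> R.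
Proof.
move=> aU; apply: le_trans (_ : 4 * tail U <= _).
  have : (#|[set f | ~~ good U j f]| <= #|[set f | ~~ good1 U j f]| +
     (#|[set f | ~~ good2 U j f]| + (#|[set f | ~~ good3 U j f]| + #|[set f | ~~ good4 U j f]|)))%N.
    apply: leq_trans (_ : #|[set f | ~~ good1 U j f] :|: ([set f | ~~ good2 U j f] :|:
       ([set f | ~~ good3 U j f] :|: [set f | ~~ good4 U j f]))| <= _)%N.
      apply/subset_leq_card/subsetP => f; rewrite !inE /good.
      by case: good1; case: good2; case: good3; case: good4.
    do 2 (apply: leq_trans (leq_card_setU _ _) _; rewrite leq_add2l).
    exact: leq_card_setU.
  rewrite -(ler_nat R) !natrD.
  by have := bad1 j aU; have := bad2 U j; have := bad3 U j; have := bad4 U j; lra.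
rewrite ler_wpM2l // ler_wpM2l ?exprn_ge0 // -expRM_natr ler_expR mulNr lerN2.
rewrite ler_pdivlMr ?mulr_gt0 //.
have : (k * #|U| * (32 * 64 * s) <= #|nb e U|)%N.
  case/andP: aU => _; apply: leq_trans; rewrite mulnAC leq_mul2r mulnC q_ge.
  by rewrite orbT.
rewrite -(ler_nat R) !natrM; lra.
Qed.

(* At each U and j the failure probability is at most 4 x ^ |U| with x tiny, because
   |nb e U| >= q |U|; the union bound is then [4 (l + 1) ((1 + x) ^ n - 1) < 1]. *)
Lemma random_layers :
  exists f, forall j, good_set e g q s K (4 * a) (layer v f j).
Proof.
pose ok f := [forall U, forall j, admissible e q U ==> good U j f].
have [/existsP[f /forallP okf]|] := boolP [exists f, ok f].
  exists f => j U aU; have := forallP (okf U) j; rewrite aU /= => /and4P[h1 h2 h3 h4].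
  by split=> //; apply/implyP.
rewrite negb_exists => /forallP none; exfalso.
pose x : R := expR (- k%:R).
have x0 : 0 <= x by rewrite expR_ge0.
have : l.+1%:R ^+ K <= \sum_(U : {set V} | U != set0) 4 * l.+1%:R * (l.+1%:R ^+ K * x ^+ #|U|) :> R.
  have EK : l.+1%:R ^+ K = #|[set: {ffun 'I_K -> 'I_l.+1}]|%:R :> R.
    by rewrite cardsT card_ffun !card_ord natrX.
  rewrite [leLHS]EK.
  have sub : [set: {ffun 'I_K -> 'I_l.+1}] \subset
      \bigcup_(U | admissible e q U) \bigcup_j [set f | ~~ good U j f].
    apply/subsetP => f _; have := none f; rewrite /ok negb_forall => /existsP[U].
    rewrite negb_forall => /existsP[j]; rewrite negb_imply => /andP[aU nU].
    by apply/bigcupP; exists U => //; apply/bigcupP; exists j; rewrite // inE.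
  apply: le_trans (_ : (\sum_(U | admissible e q U) \sum_j #|[set f | ~~ good U j f]|)%:R <= _).
    rewrite ler_nat; apply: leq_trans (subset_leq_card sub) _.
    apply: leq_trans (card_bigcup_le _ _) _.
    by apply: leq_sum => U _; apply: card_bigcup_le.
  rewrite natr_sum [leLHS]big_mkcond [leRHS]big_mkcond /=; apply: ler_sum => U _.
  case: ifP => [aU|_]; last by case: ifP => // _; rewrite !mulr_ge0 ?exprn_ge0.
  have U0 : U != set0 by case/andP: aU.
  rewrite U0 natr_sum.
  apply: le_trans (_ : \sum_(j < l.+1) 4 * (l.+1%:R ^+ K * x ^+ #|U|) <= _).
    by apply: ler_sum => j _; apply: bad.
  by rewrite sumr_const card_ord -[leLHS]mulr_natl mulrA [_ * 4]mulrC.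
rewrite -mulr_sumr -mulr_sumr.
have -> : \sum_(U : {set V} | U != set0) x ^+ #|U| = (1 + x) ^+ n - 1.
  by rewrite -sum_expr_card [in RHS](bigD1 set0) //= cards0 expr0 addrC addrK.
set P := _ ^+ K; have P0 : 0 < P by rewrite exprn_gt0.
rewrite mulrCA -[leLHS]mulr1 ler_pM2l // => big.
(* The exponent [k] was chosen for this: [expR (- k)] is at most [2 ^ -k], hence at most
   [1 / (8 s n)]. *)
have xle : n%:R * x * (8 * s%:R) <= 1.
  rewrite /x expRN; rewrite mulrAC ler_pdivrMr ?expR_gt0 // mul1r.
  apply: le_trans (_ : 2 ^+ k <= _).
    by rewrite -natrX -!natrM ler_nat mulnC.
  rewrite -[k%:R]mulr1 expRM_natl lerXn2r ?nnegrE ?expR_ge0 //.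
  by apply: le_trans (expR_ge1Dx _); lra.
set y := n%:R * x in xle.
have y0 : 0 <= y by rewrite mulr_ge0.
have ey : (1 + x) ^+ n <= expR y.
  by rewrite /y expRM_natl lerXn2r ?nnegrE ?expR_ge0 ?addr_ge0 // expR_ge1Dx.
have ey1 : expR y * (1 - y) <= 1.
  have : 1 - y <= (expR y)^-1 by rewrite -expRN; apply: expR_ge1Dx.
  by rewrite -ler_pdivlMl ?expR_gt0 // mulr1.
have s1 : 1 <= l.+1%:R :> R by rewrite ler1n.
have sl1 : l.+1%:R <= s%:R :> R by rewrite ler_nat.
have ly : l.+1%:R * y <= 8^-1 by nra.
have y8 : y <= 8^-1 by nra.
have ey2 : expR y - 1 <= 2 * y by nra.
nra.
Qed.

End UnionBound.

(** * Expander mixing *)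

Section SpectralGap.
Local Open Scope ring_scope.
Local Open Scope sesquilinear_scope.

Lemma char_poly_conj (F : comUnitRingType) n (P D : 'M[F]_n) : P \in unitmx ->
  char_poly (invmx P *m D *m P) = char_poly D.
Proof.
move=> uP; rewrite /char_poly /char_poly_mx.
pose Q := map_mx polyC P; pose Q' := map_mx polyC (invmx P).
have Q'Q : Q' *m Q = 1%:M by rewrite -map_mxM mulVmx // map_mx1.
have -> : 'X%:M - map_mx polyC (invmx P *m D *m P) =
    Q' *m ('X%:M - map_mx polyC D) *m Q.
  rewrite mulmxBr mulmxBl !map_mxM; congr (_ - _).
  by rewrite -mulmxA -scalar_mxC mulmxA Q'Q mul1mx.
by rewrite !det_mulmx mulrAC -det_mulmx Q'Q det1 mul1r.
Qed.

Variables (R : rcfType) (n : nat).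
Local Notation C := R[i].
Local Notation toC := (real_complex R).

Definition sqnorm (x : 'rV[C]_n) : C := \sum_i `|x 0 i| ^+ 2.

Lemma sqnormE x : sqnorm x = (x *m x ^t*) 0 0.
Proof. by rewrite mxE; apply: eq_bigr => i _; rewrite !mxE normCK. Qed.

Lemma sqnorm_unitary (P : 'M[C]_n) x : P \is unitarymx -> sqnorm (x *m P) = sqnorm x.
Proof.
move=> /unitarymxP PP; rewrite !sqnormE trmx_mul map_mxM !mulmxA.
by rewrite mulmxtVK //; apply/unitarymxP.
Qed.

(** The matrix is diagonalised unitarily over [R[i]]. As [lam < d], the value [d] occurs only once
    on the diagonal, so [u] has a single nonzero coordinate [i0] in the eigenbasis. Orthogonality
    makes [y] vanish at [i0], and all other coordinates are scaled by at most [lam]. *)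
Lemma symmetric_spectral_gap (A : 'M[R]_n) (d lam : R) (s : seq R) (u y : 'rV[R]_n) :
  A^T = A -> char_poly A = ('X - d%:P) * \prod_(mu <- s) ('X - mu%:P) ->
  all (fun mu => `|mu| <= lam) s -> lam < d -> u != 0 -> u *m A = d *: u ->
  y *m u^T = 0 ->
  \sum_i (y *m A) 0 i ^+ 2 <= lam ^+ 2 * \sum_i y 0 i ^+ 2.
Proof.
move=> symA chA sle lamd u0 uA yu.
pose AC : 'M[C]_n := map_mx toC A.
pose P := spectralmx AC; pose sp := spectral_diag AC.
have uP : P \is unitarymx by exact: spectral_unitarymx.
have PP : P *m P ^t* = 1%:M by apply/unitarymxP.
have PP' : P ^t* *m P = 1%:M by rewrite -invmx_unitary // mulVmx // spectral_unit.
have HA : AC = P ^t* *m diag_mx sp *m P.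
  rewrite -invmx_unitary //; apply/orthomx_spectralP.
  apply: symmetric_normalmx.
    by apply/is_hermitianmxP; rewrite expr0 scale1r map_mx_id // map_trmx symA.
  by apply/mxOverP => i j; rewrite !mxE; apply/complex_realP; exists (A i j).
(* Unique factorisation into linear factors identifies the spectral diagonal with [d :: s] up to
   order. *)
have chAC : \prod_(z <- [seq sp 0 i | i <- enum 'I_n]) ('X - z%:P) =
    \prod_(z <- map toC (d :: s)) ('X - z%:P).
  transitivity (char_poly AC).
    rewrite HA -invmx_unitary // char_poly_conj ?spectral_unit //.
    rewrite char_poly_trig ?diag_mx_is_trig // big_map big_enum /=.
    by apply: eq_bigr => i _; rewrite !mxE eqxx mulr1n.
  rewrite -map_char_poly chA rmorphM /= map_polyXsubC /= map_prod_XsubC.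
  by rewrite big_cons big_map.
have perm_sp := prod_XsubC_eq chAC.
have sp_le i : sp 0 i = toC d \/ `|sp 0 i| <= toC lam.
  have : sp 0 i \in [seq sp 0 i | i <- enum 'I_n] by rewrite map_f ?mem_enum.
  rewrite (seq.perm_mem perm_sp) /= inE => /predU1P[->|/mapP[mu muS ->]]; first by left.
  right; rewrite -[leLHS](_ : toC `|mu| = _) ?lecR; first exact: (allP sle).
  case: (lerP 0 mu) => mu0; first by rewrite !ger0_norm ?ler0c.
  by rewrite !ltr0_norm ?rmorphN // -[0]/(toC 0) ltcR.
have [i0 sp_i0] : exists i0, forall i, sp 0 i = toC d -> i = i0.
  have : size [seq i <- enum 'I_n | sp 0 i == toC d] = 1%N.
    rewrite size_filter -(count_map _ (pred1 (toC d))) (seq.permP perm_sp) /= eqxx.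
    rewrite (_ : count _ _ = 0%N) //; apply/count_memPn/mapP => -[mu muS /complexI E].
    have := allP sle mu muS; rewrite -E /= => /(le_trans (ler_norm d)).
    by rewrite leNgt lamd.
  case E: [seq i <- enum 'I_n | _] => [|i0 [|? ?]] // _; exists i0 => i /eqP sp_i.
  have : i \in [seq i <- enum 'I_n | sp 0 i == toC d] by rewrite mem_filter sp_i mem_enum.
  by rewrite E inE => /eqP.
have sp_ne i : i != i0 -> sp 0 i != toC d.
  by apply: contraNneq => /sp_i0->.
pose yC : 'rV[C]_n := map_mx toC y; pose uC : 'rV[C]_n := map_mx toC u.
pose w := uC *m P ^t*; pose z := yC *m P ^t*.
have wD : w *m diag_mx sp = toC d *: w.
  have -> : toC d *: w = uC *m AC *m P ^t* by rewrite -map_mxM uA map_mxZ scalemxAl.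
  by rewrite HA !mulmxA -[_ *m P *m _]mulmxA PP mulmx1.
have w0 i : i != i0 -> w 0 i = 0.
  move=> /sp_ne; have /rowP/(_ i) := wD; rewrite mul_mx_diag !mxE => E ne.
  apply/eqP; have /eqP := E; rewrite mulrC -subr_eq0 -mulrBl mulf_eq0 subr_eq0.
  by rewrite (negPf ne).
have wi0 : w 0 i0 != 0.
  apply: contraNneq u0 => w00; have : w = 0.
    by apply/rowP => i; rewrite [RHS]mxE; case: (eqVneq i i0) => [->|/w0].
  move=> /(congr1 (mulmx^~ P)); rewrite /w mul0mx -mulmxA PP' mulmx1 => uC0.
  apply/eqP/rowP => i; have /rowP/(_ i) := uC0; rewrite !mxE.
  by move=> /complexI.
have wt i : (w ^t*) i 0 = (w 0 i)^* by rewrite [LHS]mxE [in LHS]mxE.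
have zi0 : z 0 i0 = 0.
  have : (z *m w ^t*) 0 0 = 0.
    rewrite /z /w trmx_mul map_mxM trmxCK mulmxA -[_ *m P]mulmxA PP' mulmx1.
    have -> : uC ^t* = map_mx toC u^T.
      by apply/matrixP => i j; rewrite !mxE; apply: conjc_real.
    by rewrite -map_mxM yu map_mx0 mxE.
  rewrite mxE (bigD1 i0) //= big1 ?addr0 => [/eqP|i ne].
    by rewrite wt mulf_eq0 conjC_eq0 (negPf wi0) orbF => /eqP.
  by rewrite wt w0 // rmorph0 mulr0.
have sq (x : 'rV[R]_n) : sqnorm (map_mx toC x) = toC (\sum_i x 0 i ^+ 2).
  rewrite /sqnorm rmorph_sum; apply: eq_bigr => i _; rewrite mxE rmorphXn /=.
  by rewrite real_normK //; apply/complex_realP; exists (x 0 i).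
rewrite -lecR rmorphM /= -!sq map_mxM -/AC -/yC HA !mulmxA -/z.
rewrite sqnorm_unitary // -(sqnorm_unitary yC (_ : P ^t* \is unitarymx)); last by rewrite trmxC_unitary.
rewrite -/z /sqnorm mulr_sumr; apply: ler_sum => i _.
rewrite mul_mx_diag mxE normrM exprMn mulrC.
have [->|/sp_ne ne] := eqVneq i i0; first by rewrite zi0 normr0 expr0n !mulr0.
have [E|le] := sp_le i; first by rewrite E eqxx in ne.
by rewrite ler_wpM2r ?exprn_ge0 // rmorphXn /= lerXn2r ?nnegrE //; apply: le_trans le.
Qed.
End SpectralGap.

Section ExpanderMixing.
Local Open Scope ring_scope.

(** Cauchy-Schwarz against the indicator of [X], from the nonnegative sum of the
    [(m * t i - S) ^+ 2]. *)
Lemma sqr_sum_le (R : realFieldType) (I : finType) (X : {set I}) (t : I -> R) :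
  (\sum_(i in X) t i) ^+ 2 <= #|X|%:R * \sum_i t i ^+ 2.
Proof.
set S := \sum_(i in X) t i; set m : R := #|X|%:R.
apply: le_trans (_ : m * \sum_(i in X) t i ^+ 2 <= _); last first.
  rewrite ler_wpM2l ?ler0n // [leRHS](bigID (mem X)) /= lerDl.
  by rewrite sumr_ge0 // => i _; rewrite sqr_ge0.
have [X0|/card_gt0P[x xX]] := posnP #|X|.
  rewrite /S (_ : X = set0) ?big_set0 ?expr0n /= ?mulr0 //.
  by apply/eqP; rewrite -cards_eq0 X0.
have m0 : 0 < m by rewrite ltr0n; apply/card_gt0P; exists x.
have : 0 <= \sum_(i in X) (m * t i - S) ^+ 2 by rewrite sumr_ge0 // => i _; rewrite sqr_ge0.
have -> : \sum_(i in X) (m * t i - S) ^+ 2 =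
    m ^+ 2 * (\sum_(i in X) t i ^+ 2) - (m * S) *+ 2 * S + m * S ^+ 2.
  have -> : m * S ^+ 2 = \sum_(i in X) S ^+ 2 by rewrite sumr_const mulr_natl.
  rewrite mulr_sumr {3}/S mulr_sumr -sumrB -big_split /=.
  by apply: eq_bigr => i _; ring.
move: (\sum_(i in X) _) => Q h; rewrite -subr_ge0 -(pmulr_rge0 _ m0).
by apply: le_trans h _; rewrite le_eqVlt; apply/orP; left; apply/eqP; ring.
Qed.

Variables (R : realType) (n : nat) (e : rel 'I_n) (d : nat) (lam : R).
Hypothesis G : ndl_graph e d lam.
Implicit Types (X Y : {set 'I_n}).

Lemma card_nb_adj x Y : #|nb e [set x] :&: Y|%:R = \sum_(y in Y) (e x y)%:R :> R.
Proof.
rewrite -natr_sum; congr _%:R; rewrite -sum1_card [RHS]big_mkcond [LHS]big_mkcond /=.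
by apply: eq_bigr => y _; rewrite inE nb1E; case: (y \in Y); rewrite ?andbT ?andbF //; case: (e x y).
Qed.

Lemma ndl_deg x : #|nb e [set x]| = d.
Proof.
have [_ reg _] := G; rewrite -(reg x); apply: eq_card => y.
by rewrite nb1E inE.
Qed.

(** The spectral gap is applied to [y], which is [n] times the projection of the indicator of [Y]
    orthogonal to the constants. Summing the entries of [y *m A] over [X] gives the discrepancy,
    bounded by Cauchy-Schwarz. *)
Lemma expander_mixing X Y : lam < d%:R ->
  (n%:R * (\sum_(x in X) #|nb e [set x] :&: Y|)%:R - d%:R * #|X|%:R * #|Y|%:R) ^+ 2 <=
    lam ^+ 2 * n%:R ^+ 2 * #|X|%:R * #|Y|%:R.
Proof.
move=> lamd; have [[e_sym _] reg [s [chA sle]]] := G.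
pose A := adjmx R e; pose u : 'rV[R]_n := const_mx 1.
pose y : 'rV[R]_n := \row_j (n%:R * (j \in Y)%:R - #|Y|%:R).
have sumY : \sum_j (j \in Y)%:R = #|Y|%:R :> R.
  rewrite -sum1_card natr_sum [RHS]big_mkcond /=.
  by apply: eq_bigr => j _; case: (j \in Y).
have rowA x : \sum_j (e x j)%:R = d%:R :> R.
  have := card_nb_adj x setT; rewrite setIT ndl_deg => ->.
  by apply: eq_bigl => j; rewrite inE.
have symA : A^T = A by apply/matrixP => i j; rewrite !mxE e_sym.
have [n0|n_gt0] := posnP n.
  have -> : X = set0.
    by apply/eqP; rewrite -cards_eq0 -leqn0 -n0 -[leqRHS]card_ord max_card.
  by rewrite big_set0 cards0 !mulr0 !mul0r subr0 expr0n.
have u0 : u != 0.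
  by apply/eqP => /rowP/(_ (Ordinal n_gt0)); rewrite !mxE => /eqP; rewrite oner_eq0.
have uA : u *m A = d%:R *: u.
  apply/rowP => j; rewrite !mxE mulr1 -(rowA j); apply: eq_bigr => i _.
  by rewrite !mxE mul1r e_sym.
have yu : y *m u^T = 0.
  apply/matrixP => i j; rewrite !mxE.
  under eq_bigr => k _ do rewrite !mxE mulr1.
  by rewrite sumrB -mulr_sumr sumY sumr_const card_ord -[#|Y|%:R *+ n]mulr_natl subrr.
have yA x : (y *m A) 0 x = n%:R * #|nb e [set x] :&: Y|%:R - d%:R * #|Y|%:R.
  have -> : #|nb e [set x] :&: Y|%:R = \sum_k (k \in Y)%:R * (e x k)%:R :> R.
    rewrite card_nb_adj big_mkcond /=; apply: eq_bigr => k _.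
    by case: (k \in Y); rewrite ?mul1r ?mul0r.
  rewrite mxE -(rowA x) mulr_sumr mulr_suml -sumrB.
  by apply: eq_bigr => k _; rewrite !mxE e_sym; ring.
have y2 : \sum_i y 0 i ^+ 2 <= n%:R ^+ 2 * #|Y|%:R.
  rewrite -sumY mulr_sumr.
  apply: le_trans (_ : \sum_i (n%:R ^+ 2 * (i \in Y)%:R - (#|Y|%:R * n%:R *+ 2) * (i \in Y)%:R + #|Y|%:R ^+ 2) <= _).
    rewrite le_eqVlt; apply/orP; left; apply/eqP; apply: eq_bigr => i _.
    by rewrite mxE; case: (i \in Y) => /=; ring.
  rewrite big_split sumrB /= -!mulr_sumr sumY sumr_const card_ord -[#|Y|%:R *+ n]mulr_natl.
  have : 0 <= n%:R * #|Y|%:R ^+ 2 :> R by rewrite mulr_ge0 ?ler0n ?sqr_ge0.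
  lra.
have gap := symmetric_spectral_gap symA chA sle lamd u0 uA yu.
have -> : n%:R * (\sum_(x in X) #|nb e [set x] :&: Y|)%:R - d%:R * #|X|%:R * #|Y|%:R =
    \sum_(x in X) (y *m A) 0 x.
  rewrite (eq_bigr (fun x => n%:R * #|nb e [set x] :&: Y|%:R - d%:R * #|Y|%:R)) => [|x _]; last exact: yA.
  by rewrite sumrB -mulr_sumr natr_sum sumr_const -[_ *+ #|X|]mulr_natl; ring.
apply: le_trans (sqr_sum_le _ _) _.
have -> : lam ^+ 2 * n%:R ^+ 2 * #|X|%:R * #|Y|%:R = #|X|%:R * (lam ^+ 2 * (n%:R ^+ 2 * #|Y|%:R)).
  by ring.
rewrite ler_wpM2l ?ler0n //.
apply: le_trans gap _; by rewrite ler_wpM2l ?sqr_ge0.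
Qed.

(** In the first case the edges between [X] and [Y] are at least twice the expected number, in the
    second at most half of it. So the discrepancy is at least half of the larger quantity, and
    squaring gives the bounds. *)
Lemma ndl_mixing (c : nat) : (1 < c)%N -> 0 < lam -> c%:R <= d%:R / lam -> mixing e d c.
Proof.
move=> c_gt1 lam0; rewrite ler_pdivlMr // => clam.
have lamd : lam < d%:R.
  by apply: lt_le_trans clam; rewrite ltr_pMl // ltr1n.
have d0 : 0 < d%:R :> R by apply: lt_trans lamd.
have mix X Y : c%:R ^+ 2 * (n%:R * (\sum_(x in X) #|nb e [set x] :&: Y|)%:R - d%:R * #|X|%:R * #|Y|%:R) ^+ 2 <=
    d%:R ^+ 2 * n%:R ^+ 2 * #|X|%:R * #|Y|%:R :> R.
  have c0 : 0 <= c%:R ^+ 2 :> R by rewrite sqr_ge0.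
  apply: le_trans (ler_wpM2l c0 (expander_mixing X Y lamd)) _.
  have -> : c%:R ^+ 2 * (lam ^+ 2 * n%:R ^+ 2 * #|X|%:R * #|Y|%:R) =
      (c%:R * lam) ^+ 2 * (n%:R ^+ 2 * #|X|%:R * #|Y|%:R) by ring.
  have -> : d%:R ^+ 2 * n%:R ^+ 2 * #|X|%:R * #|Y|%:R =
      d%:R ^+ 2 * (n%:R ^+ 2 * #|X|%:R * #|Y|%:R) :> R by ring.
  apply: ler_wpM2r; first by rewrite !mulr_ge0 ?exprn_ge0.
  by rewrite lerXn2r // nnegrE ?mulr_ge0 ?ler0n ?ltW.
have [n0|n_gt0] := posnP n.
  have z (X : {set 'I_n}) : #|X| = 0%N.
    by apply/eqP; rewrite -leqn0 -n0 -[leqRHS]card_ord max_card.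
  by split=> s X Y _ _; rewrite !z !muln0.
have n0 : 0 < n%:R :> R by rewrite ltr0n.
split=> s X Y; rewrite card_ord => hX hY.
  have [->|X0] := posnP #|X|; first by rewrite muln0.
  have x0 : 0 < #|X|%:R :> R by rewrite ltr0n.
  have := mix X Y; set E := (\sum_(_ in _) _)%N => mXY.
  have hE : (d * #|X| <= s * E)%N.
    by rewrite /E mulnC -sum_nat_const big_distrr /=; apply: leq_sum.
  rewrite -(ler_nat R) !natrM ?natrX; move: hE hY.
  rewrite -!(ler_nat R) !natrM.
  move: (#|X|%:R : R) (#|Y|%:R : R) (E%:R : R) (s%:R : R) (ler0n R s) (ler0n R #|Y|) x0 mXY d0 n0.
  move: (d%:R : R) (n%:R : R) (c%:R : R) => D N k x y E' s' s0 y0 x0 mXY D0 N0 hE hY.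
  have h1 : 0 <= D * x * N / 2 by rewrite divr_ge0 ?mulr_ge0 ?ltW.
  have h2 : D * x * N / 2 <= s' * (N * E' - D * x * y).
    have : D * x * (2 * s' * y) <= D * x * N by apply: ler_wpM2l => //; rewrite mulr_ge0 ?ltW.
    have : N * (D * x) <= N * (s' * E') by apply: ler_wpM2l => //; apply: ltW.
    lra.
  have h3 : (D * x * N / 2) ^+ 2 <= (s' * (N * E' - D * x * y)) ^+ 2.
    by rewrite lerXn2r ?nnegrE // (le_trans h1).
  have h4 : k ^+ 2 * (D * x * N / 2) ^+ 2 <= s' ^+ 2 * (D ^+ 2 * N ^+ 2 * x * y).
    apply: le_trans (ler_wpM2l (sqr_ge0 k) h3) _.
    have := ler_wpM2l (sqr_ge0 s') mXY; rewrite exprMn; lra.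
  have P0 : 0 < D ^+ 2 * N ^+ 2 * x / 4 by rewrite !mulr_gt0 ?exprn_gt0 ?invr_gt0.
  rewrite -(ler_pM2l P0); lra.
have [->|X0] := posnP #|X|; first by rewrite muln0.
have [->|Y0] := posnP #|Y|; first by rewrite muln0.
have x0 : 0 < #|X|%:R :> R by rewrite ltr0n.
have y0 : 0 < #|Y|%:R :> R by rewrite ltr0n.
have := mix X Y; set E := (\sum_(_ in _) _)%N => mXY.
have hE : (s * E <= d * #|X|)%N.
  by rewrite /E mulnC [leqRHS]mulnC -sum_nat_const big_distrl /=; apply: leq_sum => x; rewrite mulnC; apply: hX.
have s_gt0 : (0 < s)%N by move: hY; case: (s) => //; rewrite mul0n leqn0 muln_eq0 /= eqn0Ngt n_gt0.
have s0 : 0 < s%:R :> R by rewrite ltr0n.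
rewrite -(ler_nat R) !natrM ?natrX; move: hE hY.
rewrite -!(ler_nat R) !natrM.
move: (#|X|%:R : R) (#|Y|%:R : R) (E%:R : R) (s%:R : R) s0 y0 x0 mXY d0 n0.
move: (d%:R : R) (n%:R : R) (c%:R : R) => D N k x y E' s' s0 y0 x0 mXY D0 N0 hE hY.
have h1 : 0 <= s' * (D * x * y) / 2 by rewrite divr_ge0 ?mulr_ge0 ?ltW.
have h2 : s' * (D * x * y) / 2 <= s' * (D * x * y - N * E').
  have : D * x * (2 * N) <= D * x * (s' * y) by apply: ler_wpM2l => //; rewrite mulr_ge0 ?ltW.
  have : N * (s' * E') <= N * (D * x) by apply: ler_wpM2l => //; apply: ltW.
  lra.
have h3 : D * x * y / 2 <= D * x * y - N * E' by rewrite -(ler_pM2l s0) mulrA.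
have h4 : (D * x * y / 2) ^+ 2 <= (D * x * y - N * E') ^+ 2.
  by rewrite lerXn2r ?nnegrE // ?(le_trans _ h3) // divr_ge0 ?mulr_ge0 ?ltW.
have h5 : k ^+ 2 * (D * x * y / 2) ^+ 2 <= D ^+ 2 * N ^+ 2 * x * y.
  apply: le_trans mXY; rewrite ler_wpM2l ?sqr_ge0 //.
  by apply: le_trans h4 _; rewrite -sqrrN opprB lexx.
have P0 : 0 < D ^+ 2 * x * y / 4 by rewrite !mulr_gt0 ?exprn_gt0 ?invr_gt0.
rewrite -(ler_pM2l P0); lra.
Qed.

(** A loopless graph has trace 0, so [d] is minus the sum of the other [n - 1] eigenvalues and is at
    most [(n - 1) lam]. *)
Lemma ndl_card_gt (c : nat) : 0 < lam -> (0 < n)%N -> c%:R <= d%:R / lam -> (c < n)%N.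
Proof.
move=> lam0 n_gt0; rewrite ler_pdivlMr // => clam.
have [[_ e_irr] _ [s [chA sle]]] := G.
have chA' : char_poly (adjmx R e) = \prod_(z <- d%:R :: s) ('X - z%:P) by rewrite big_cons.
have sz : size s = n.-1.
  have := size_char_poly (adjmx R e); rewrite chA' size_prod_XsubC /= => -[<-].
  by [].
have := char_poly_trace (adjmx R e) n_gt0; rewrite chA' -sz.
rewrite [(size s)](_ : _ = (size (d%:R :: s)).-1) // coefPn_prod_XsubC // => /oppr_inj.
have -> : \tr (adjmx R e) = 0.
  by rewrite /mxtrace big1 // => i _; rewrite mxE e_irr.
rewrite big_cons => /eqP; rewrite addr_eq0 => /eqP dE.
have : d%:R <= (size s)%:R * lam.
  rewrite dE; elim: (s) sle => [|mu t IH] /=; first by rewrite big_nil oppr0 mul0r.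
  move=> /andP[hmu /IH ht]; rewrite big_cons opprD -[(size t).+1]addn1 natrD mulrDl mul1r addrC.
  by apply: lerD => //; apply: le_trans hmu; rewrite -normrN ler_norm.
move=> /(le_trans clam); rewrite ler_pM2r // ler_nat sz => le.
by rewrite -(prednK n_gt0) ltnS.
Qed.

End ExpanderMixing.

(** * Partition of the vertex set *)

Section Layers.
Variables (V : finType) (K l : nat).
Implicit Types (v : 'I_K -> 'I_l.+1 -> V) (f : {ffun 'I_K -> 'I_l.+1}) (S Y : {set V}).

Lemma grid_of_set S : 0 < #|V| -> #|S| = K * l.+1 ->
  exists v, (forall g a g' a', v g a = v g' a' -> g = g' /\ a = a') /\ grid v = S.
Proof.
move=> /card_gt0P[x0 _] cS; pose v (g : 'I_K) (a : 'I_l.+1) := nth x0 (enum S) (g * l.+1 + a).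
have lt (g : 'I_K) (a : 'I_l.+1) : g * l.+1 + a < size (enum S).
  rewrite -cardE cS; apply: leq_trans (_ : g.+1 * l.+1 <= _); last by rewrite leq_mul2r ltn_ord orbT.
  by rewrite mulSn addnC ltn_add2r.
have v_inj g a g' a' : v g a = v g' a' -> g = g' /\ a = a'.
  move/eqP; rewrite nth_uniq ?enum_uniq // => /eqP E; split; apply/val_inj.
    by have := congr1 (divn^~ l.+1) E; rewrite !divnMDl // !divn_small // !addn0.
  by have := congr1 (modn^~ l.+1) E; rewrite !modnMDl !modn_small.
exists v; split=> //; apply/eqP; rewrite eqEcard; apply/andP; split.
  by apply/subsetP => _ /imsetP[[g a] _ ->]; rewrite -mem_enum mem_nth.
rewrite card_imset => [|[g a] [g' a'] /v_inj[/= -> ->] //].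
by rewrite card_prod !card_ord cS.
Qed.

Variable v : 'I_K -> 'I_l.+1 -> V.
Hypothesis v_inj : forall g a g' a', v g a = v g' a' -> g = g' /\ a = a'.
Variable f : {ffun 'I_K -> 'I_l.+1}.

Lemma layer_disjoint j j' x : x \in layer v f j -> x \in layer v f j' -> j = j'.
Proof. by move=> /imsetP[g _ ->] /imsetP[g' _ /v_inj[<- /addIr]]. Qed.

Lemma layer_cover x : (x \in grid v) = [exists j, x \in layer v f j].
Proof.
apply/imsetP/existsP => [[[g a] _ ->]|[j /imsetP[g _ ->]]]; last by exists (g, (j + f g)%R).
exists (a - f g)%R; apply/imsetP; exists g => //=.
by rewrite subrK.
Qed.

Lemma card_layers (J : {set 'I_l.+1}) Y :
  #|(\bigcup_(j in J) layer v f j) :&: Y| = \sum_(j in J) #|layer v f j :&: Y|.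
Proof.
have cardI (A : {set V}) : #|A :&: Y| = \sum_(y in Y) (y \in A).
  rewrite -sum1_card [RHS]big_mkcond [LHS]big_mkcond /=.
  by apply: eq_bigr => y _; rewrite inE; case: (y \in Y); case: (y \in A).
rewrite cardI (eq_bigr _ (fun j _ => cardI _)) exchange_big /=.
apply: eq_bigr => y _; case: bigcupP => [[j jJ yj]|no] /=.
  rewrite (bigD1 j) //= yj big1 // => j' /andP[_ j'j].
  by case yj' : (_ \in _) => //; rewrite (layer_disjoint yj yj') eqxx in j'j.
by rewrite big1 // => j jJ; case yj : (_ \in _) => //; case: no; exists j.
Qed.

End Layers.

Lemma card_ord_interval (L a b : nat) : b <= L ->
  b - a <= #|[set j : 'I_L | a <= j < b]|.
Proof.
case: L => [|L] bL; first by move: bL; rewrite leqn0 => /eqP ->.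
have vt (t : 'I_(b - a)) : (inord (a + t) : 'I_L.+1) = a + t :> nat.
  by rewrite inordK //; have := ltn_ord t; lia.
rewrite -[leqLHS]card_ord -(card_imset (f := fun t : 'I_(b - a) => inord (a + t) : 'I_L.+1)).
  apply/subset_leq_card/subsetP => _ /imsetP[t _ ->]; rewrite inE vt.
  by have := ltn_ord t; lia.
by move=> t t' /(congr1 val); rewrite /= !vt => /addnI/val_inj.
Qed.

Section FirstPartition.
Variables (R : realType) (V : finType) (e : rel V) (d c g q l K k : nat).
Local Notation n := #|V|.
Local Notation N x := (nb e [set x]).
Hypotheses (deg : forall x, #|N x| = d) (mix : mixing e d c).
Hypotheses (gq : 2 * g * q <= d) (g_ge : 64 * 64 <= g) (gc : 4 * g <= c).
Hypotheses (k_ge : 8 * l.+1 * n <= 2 ^ k) (q_ge : 32 * 64 * l.+1 * k <= q) (n_gt0 : 0 < n).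
Hypotheses (KE : K = n %/ l.+1) (K_gt0 : 0 < K) (l_ge : 8 <= l.+1).

Local Notation good kappa := (good_set e g q l.+1 K kappa).

Lemma k_gt0 : 0 < k.
Proof.
rewrite lt0n; apply: contraTneq k_ge => ->; rewrite expn0 -ltnNge -mulnA.
by apply: (@leq_trans (8 * 1)) => //; rewrite leq_mul2l muln_gt0.
Qed.

Lemma q_ge2 : 2 * l.+1 <= q.
Proof.
apply: leq_trans q_ge; apply: leq_trans (_ : 32 * 64 * l.+1 * 1 <= _).
  by rewrite muln1 leq_mul2r.
by rewrite leq_mul2l k_gt0 orbT.
Qed.

Lemma q_gt0 : 0 < q.
Proof. exact: leq_trans q_ge2. Qed.

Lemma g_gt1 : 1 < g.
Proof. exact: leq_trans g_ge. Qed.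

Lemma gc2 : 2 * g < c.
Proof.
apply: leq_trans gc; have := g_gt1; clear; lia.
Qed.

Lemma random_layers_of_set (a l' : nat) (S : {set V}) : l' <= l -> l.+1 <= 2 * l'.+1 -> a <= 16 ->
  #|S| = K * l'.+1 ->
  (forall U, admissible e q U -> #|nb e U| <= a * #|nb e U :&: S|) ->
  exists v (f : {ffun 'I_K -> 'I_l'.+1}), [/\ forall g a g' a', v g a = v g' a' -> g = g' /\ a = a',
    grid v = S & forall j, good (4 * a) (layer v f j)].
Proof.
move=> l'l ll' a16 cS dens; have [v [v_inj gv]] := grid_of_set n_gt0 cS.
have nK : n <= 2 * K * l.+1.
  have n_lt : n < K * l.+1 + l.+1.
    by rewrite {1}(divn_eq n l.+1) -KE ltn_add2l ltn_pmod.
  have : l.+1 <= K * l.+1 by rewrite leq_pmull.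
  by move: n_lt; rewrite -mulnA; clear; move: (K * l.+1); lia.
have c91 : 91 <= c.
  by apply: leq_trans gc; apply: leq_trans (leq_mul (leqnn 4) g_ge).
have [||f goodf] := @random_layers R V e c g q l.+1 K l' k a v v_inj l'l ll'
  nK a16 c91 g_ge k_ge q_ge _ _; last by exists v, f.
- by move=> U aU; rewrite gv; apply: dens.
- move=> U; exact: (core_small deg mix gq g_gt1).
Qed.

(** Layer 0 becomes [A], layer 1 becomes [I], about a quarter of the layers form [P], and the rest
    [Q] stays outside. The gadgets consume vertices of [P] in an uncontrolled way, so the density
    needed for the second cut is secured by [Q] alone. *)
Lemma first_partition : exists A I P : {set V},
  [/\ #|A| = K, #|I| = K, good 8 A & good 8 I] /\
  [/\ [disjoint A & I], [disjoint P & A :|: I], n <= 16 * #|P|,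
      forall U, admissible e q U -> #|nb e U| <= 64 * #|P :&: nb e U| &
      forall U, admissible e q U -> #|nb e U| <= 16 * #|nb e U :\: (A :|: I :|: P)|].
Proof.
pose S := [set x in take (K * l.+1) (enum V)].
have Kn : K * l.+1 <= n by rewrite KE leq_divM.
have cS : #|S| = K * l.+1.
  rewrite cardsE (card_uniqP _) ?take_uniq ?enum_uniq // size_takel //.
  by rewrite -cardE.
(* Fewer than [l.+1] vertices lie outside [S], while [#|nb e U| >= q >= 2 * l.+1]. *)
have dens U : admissible e q U -> #|nb e U| <= 2 * #|nb e U :&: S|.
  case/andP=> U0 qU; have := cardsID S (nb e U); have := cardsC S.
  have : #|nb e U :\: S| <= #|~: S| by rewrite setDE subset_leq_card // subsetIr.
  have : n < K * l.+1 + l.+1.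
    by rewrite {1}(divn_eq n l.+1) -KE ltn_add2l ltn_pmod.
  have : q * 1 <= q * #|U| by rewrite leq_mul2l card_gt0 U0 orbT.
  have := q_ge2; rewrite cS; lia.
have ll2 : l.+1 <= 2 * l.+1 by rewrite leq_pmull.
have [v [f [v_inj gv goodf]]] := random_layers_of_set (leqnn l) ll2 (isT : 2 <= 16) cS dens.
(* With [a = 2] each layer is good for [kappa = 8]. At least 1/8 of the layers go to [P] and at
   least 1/2 to [Q], which gives the factors 64 and 16 of the statement. *)
pose u := l.+1 %/ 4.
have [u1 u2] : 8 * u >= l.+1 /\ 4 * u <= l.+1.
  by rewrite /u; move: l_ge; clear; lia.
pose JP := [set j : 'I_l.+1 | 2 <= j < 2 + u].
pose JQ := [set j : 'I_l.+1 | 2 + u <= j < l.+1].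
have cJP : u <= #|JP|.
  apply: leq_trans (card_ord_interval 2 (_ : 2 + u <= l.+1)); first by rewrite addKn.
  by move: l_ge u2; clear; lia.
have cJQ : l.+1 <= 2 * #|JQ|.
  have := card_ord_interval (2 + u) (leqnn l.+1); rewrite -/JQ.
  by move: l_ge u2; clear; lia.
have o1 : (inord 1 : 'I_l.+1) = 1 :> nat by rewrite inordK //; move: l_ge; clear; lia.
pose A := layer v f ord0; pose I := layer v f (inord 1).
pose P := \bigcup_(j in JP) layer v f j; pose Q := \bigcup_(j in JQ) layer v f j.
have dis (J : {set 'I_l.+1}) j x : x \in \bigcup_(i in J) layer v f i -> x \in layer v f j -> j \in J.
  by case/bigcupP=> i iJ xi xj; rewrite (layer_disjoint v_inj xj xi).
have dPQ x : x \in P -> x \notin Q.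
  case/bigcupP=> i; rewrite inE => /andP[_ iu] xi; apply/negP => /dis/(_ xi).
  by rewrite inE leqNgt iu.
have nA (J : {set 'I_l.+1}) x : ord0 \notin J -> x \in \bigcup_(i in J) layer v f i -> x \notin A.
  by move=> + /dis xJ; apply: contra => /xJ.
have nI (J : {set 'I_l.+1}) x : inord 1 \notin J -> x \in \bigcup_(i in J) layer v f i -> x \notin I.
  by move=> + /dis xJ; apply: contra => /xJ.
have dens_layers (J : {set 'I_l.+1}) U : admissible e q U ->
    #|J| * #|nb e U| <= 8 * l.+1 * #|(\bigcup_(j in J) layer v f j) :&: nb e U|.
  move=> aU; rewrite (card_layers v_inj) big_distrr /= -sum_nat_const.
  by apply: leq_sum => j _; have [] := goodf j U aU.
exists A, I, P; split; split; rewrite ?card_layer //; try exact: goodf.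
- rewrite -setI_eq0; apply/eqP/setP=> x; rewrite !inE; apply/negP => /andP[xA xI].
  by have /(congr1 val) := layer_disjoint v_inj xA xI; rewrite /= o1.
- rewrite -setI_eq0; apply/eqP/setP=> x; rewrite in_set0 in_setI in_setU.
  apply/negP => /andP[xP]; rewrite (negPf (nA _ _ _ xP)) ?(negPf (nI _ _ _ xP)) //.
    by rewrite inE o1.
  by rewrite inE.
- have -> : #|P| = #|JP| * K.
    rewrite -[P]setIT (card_layers v_inj) -sum_nat_const.
    by apply: eq_bigr => j _; rewrite setIT card_layer.
  have : n < K * l.+1 + l.+1.
    by rewrite {1}(divn_eq n l.+1) -KE ltn_add2l ltn_pmod.
  have : l.+1 <= K * l.+1 by rewrite leq_pmull.
  have : K * l.+1 <= K * (8 * #|JP|).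
    by rewrite leq_mul2l (leq_trans u1) ?orbT // leq_mul2l cJP orbT.
  by clear; move: (K * l.+1); lia.
- move=> U aU; have := dens_layers JP U aU; rewrite -/P => dP.
  rewrite -(leq_pmul2l (ltn0Sn l)).
  apply: leq_trans (_ : 8 * #|JP| * #|nb e U| <= _).
    by rewrite leq_mul2r (leq_trans u1) ?orbT // leq_mul2l cJP orbT.
  by move: dP; clear; move: #|JP| l.+1 #|_| #|_| => a b y z; lia.
- move=> U aU; have := dens_layers JQ U aU; rewrite -/Q => dQ.
  rewrite -(leq_pmul2l (ltn0Sn l)).
  apply: leq_trans (_ : 2 * #|JQ| * #|nb e U| <= _); first by rewrite leq_mul2r cJQ orbT.
  have : #|Q :&: nb e U| <= #|nb e U :\: (A :|: I :|: P)|.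
    apply/subset_leq_card/subsetP => x /setIP[xQ xU].
    rewrite in_setD xU andbT !in_setU !negb_or (nA _ _ _ xQ) ?(nI _ _ _ xQ) ?inE ?o1 //=.
    by apply: contraL xQ; apply: dPQ.
  rewrite -(leq_pmul2l (ltn0Sn l)); move: dQ; clear.
  by move: #|JQ| l.+1 #|_| #|_| #|_| => a b y z w; lia.
Qed.
End FirstPartition.

(** * Assembling the Hamilton cycle *)

Section Core.
Variables (R : realType) (V : finType) (e : rel V) (d c g q l k k0 h0 m : nat).
Local Notation n := #|V|.
Local Notation N x := (nb e [set x]).
Local Notation K := k0.+1.
Local Notation h := h0.+1.
Hypotheses (e_sym : symmetric e) (deg : forall x, #|N x| = d) (mix : mixing e d c).
Hypotheses (gq : 2 * g * q <= d) (g_ge : 64 * 64 <= g) (gc : 4 * g <= c).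
Hypotheses (k_ge : 8 * l.+1 * n <= 2 ^ k) (q_ge : 32 * 64 * l.+1 * k <= q) (n_gt0 : 0 < n).
Hypotheses (KE : K = n %/ l.+1) (K_ge : 64 <= K) (hl : 128 * (h * h.+1) <= l.+1).
Hypotheses (m_gt0 : 0 < m) (m_le : 1024 * m <= n) (m_ge : n <= 2048 * m).
Hypotheses (mh : m <= 2 ^ h) (hm : 2 ^ h <= 2 * m).

Local Notation good kappa := (good_set e g q l.+1 K kappa).

Let l_ge : 8 <= l.+1.
Proof. by apply: leq_trans hl; rewrite !mulnS; clear; lia. Qed.

Let qp : 0 < q.
Proof. exact: q_gt0 k_ge q_ge n_gt0. Qed.

Let q_le : q <= d.
Proof. by apply: leq_qd gq _; apply: leq_trans g_ge. Qed.

Let c_large : 8 * (2048 * m) <= c * m.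
Proof.
rewrite mulnA leq_mul2r; apply/orP; right; apply: leq_trans gc.
by apply: leq_trans (leq_mul (leqnn 4) g_ge); clear; lia.
Qed.

(** If there were no edge, the second mixing bound with [s = 2 n] would give [(c m) ^ 2 <= 4 n ^ 2],
    but [c m >= 8 n] since [c >= 8 * 2048]. *)
Let joined : forall U T : {set V}, m <= #|U| -> m <= #|T| ->
  exists x y, [/\ x \in U, y \in T & e x y].
Proof.
move=> U T mU mT; have [/exists_inP[x xU /exists_inP[y yT exy]]|] :=
    boolP [exists x in U, [exists y in T, e x y]]; first by exists x, y.
rewrite negb_exists_in => /forall_inP none; exfalso.
have h1 x : x \in U -> 2 * n * #|N x :&: T| <= d.
  move=> /none; rewrite negb_exists_in => /forall_inP no.
  rewrite (_ : _ :&: _ = set0) ?cards0 ?muln0 //.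
  by apply/setP=> y; rewrite !inE nb1E; apply/negP => /andP[exy /no]; rewrite exy.
have h2 : 2 * n <= 2 * n * #|T| by rewrite leq_pmulr // (leq_trans m_gt0).
have := mix.2 _ _ _ h1 h2; apply/negP; rewrite -ltnNge.
apply: leq_trans (_ : (c * m) ^ 2 <= _); last first.
  by rewrite expnMn -mulnA leq_mul2l (leq_mul mU mT) orbT.
apply: leq_trans (_ : (8 * n) ^ 2 <= _).
  by rewrite expnMn ltn_pmul2r ?expn_gt0 ?n_gt0.
by rewrite leq_sqr (leq_trans _ c_large) // leq_mul2l m_ge orbT.
Qed.

Let admissible1 x : admissible e q [set x].
Proof. by rewrite /admissible cards1 muln1 deg q_le andbT -card_gt0 cards1. Qed.

(** Density at singletons gives each vertex at least [d / 64] neighbours in [P]. If [nb e U :&: P]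
    has at most [n / 128] elements, the first mixing bound and [c >= 4 * 64] make it at least
    [4 #|U|]; otherwise it exceeds [n / 128 >= 8 m]. *)
Let ext0 (P : {set V}) : (forall U, admissible e q U -> #|nb e U| <= 64 * #|P :&: nb e U|) ->
  extendable e P m set0.
Proof.
move=> dens; split=> [a b|a|U cU]; rewrite ?inE //.
rewrite (_ : P :\: _ = P); last by rewrite /children imset0 setD0.
apply: leq_trans (leq_addr _ _); set Y := nb e U :&: P.
have h1 x : x \in U -> d <= 64 * #|N x :&: Y|.
  move=> xU; rewrite -(deg x); apply: leq_trans (dens _ (admissible1 x)) _.
  rewrite leq_mul2l subset_leq_card ?orbT //; apply/subsetP => y /setIP[yP yx].
  rewrite !in_setI yx yP andbT; apply: (subsetP (nbS e _) _ yx).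
  by rewrite sub1set.
have [Yn|Yn] := leqP (2 * 64 * #|Y|) n; last first.
  by move: cU m_le Yn; clear; lia.
have := mix.1 _ _ _ h1 Yn.
have cc : 4 ^ 2 * 64 ^ 2 <= c ^ 2.
  by rewrite -expnMn leq_sqr (leq_trans _ gc) // leq_mul2l (leq_trans _ g_ge).
move=> /(leq_trans (leq_mul cc (leqnn #|U|))).
have : 0 < 64 ^ 2 by rewrite expn_gt0.
move: (64 ^ 2) => s s0; rewrite (_ : 4 ^ 2 * s * #|U| = 4 * s * (4 * #|U|)).
  by rewrite leq_pmul2l ?muln_gt0 //; apply: leq_trans; rewrite leq_mul2r orbT.
by move: #|U|; clear -s; lia.
Qed.

Let good_mono kappa kappa' W : kappa <= kappa' -> good kappa W -> good kappa' W.
Proof.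
move=> kk gW U aU; have [h1 h2 h3 h4] := gW U aU; split=> //.
by apply: leq_trans h1 _; rewrite leq_mul2r leq_mul2r kk !orbT.
Qed.

Let matching W W' : good 64 W /\ #|W| = K -> good 64 W' /\ #|W'| = K ->
  exists2 f : V -> V, {in W &, injective f} & forall x, x \in W -> f x \in W' /\ e x (f x).
Proof.
move=> [gW cW] [gW' cW'].
apply: (good_matching (kappa := 64) e_sym deg mix qp gq (g_gt1 g_ge) (gc2 g_ge gc) n_gt0 (ltn0Sn l)) gW gW' _ cW cW' => //.
by rewrite KE leq_divM.
Qed.

Lemma hamilton_cycle : exists S : seq V, [/\ uniq S, size S = n & path.cycle e S].
Proof.
have [A [I [P [[cA cI gA gI] [dAI dP cP dens1 dens2]]]]] :=
  first_partition R deg mix gq g_ge gc k_ge q_ge n_gt0 KE isT l_ge.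
have gA' : good 64 A by apply: good_mono gA.
have gI' : good 64 I by apply: good_mono gI.
have [f f_inj fP] := matching (conj gA' cA) (conj gI' cI).
pose r := n %% l.+1.
have nE : n = K * l.+1 + r by rewrite KE -divn_eq.
have r_lt : r < l.+1 by rewrite ltn_pmod.
(* All links together, the padding, and the working space [7 m + 4 * 2 ^ h <= 15 m] each take at
   most [n / 64], whereas [P] has at least [n / 16] vertices. *)
have room : 2 * h * (K * h.+1) + r + 7 * m + 2 ^ h.+2 <= #|P|.
  have e1 : 64 * (2 * h * (K * h.+1)) <= K * l.+1.
    have -> : 64 * (2 * h * (K * h.+1)) = K * (128 * (h * h.+1)) by clear; lia.
    by rewrite leq_mul2l hl orbT.
  have e2 : 64 * l.+1 <= K * l.+1 by rewrite leq_mul2r K_ge orbT.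
  have e3 : 2 ^ h.+2 = 4 * 2 ^ h by rewrite !expnS mulnA.
  rewrite e3; move: e1 e2 nE r_lt cP m_le hm.
  move: (2 * h * _) (K * l.+1) (2 ^ h) #|P| => x y z w; clear; lia.
have [i [a [b [c' [Bs [outb [T [[[a_inj i_inj] AE IE TP cT] [eij zz outbP [sBs soutb] covT]]]]]]]]] :=
  gadget_network e_sym joined m_gt0 cA cI dAI dP f_inj fP (ext0 dens1) mh room.
pose X := ~: (A :|: I :|: T).
(* Per gadget, the two vertices [a j], [i j] and the [2 * h * h.+1] link vertices are removed from a
   share of [l.+1]. The padding takes the remainder [r], so [X] has exactly [K * l'.+1] vertices. *)
pose l' := l - 2 - 2 * (h * h.+1).
have hh : 0 < h * h.+1 by rewrite muln_gt0.
have l'E : l.+1 = l'.+1 + 2 + 2 * (h * h.+1).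
  by rewrite /l'; move: hl hh; move: (h * h.+1); clear; lia.
have cX : #|X| = K * l'.+1.
  have cU : #|A :|: I :|: T| = K + K + (2 * h * (K * h.+1) + r).
    rewrite cardsU cardsU cA cI cT (disjoint_setI0 dAI) cards0 subn0.
    rewrite (_ : _ :&: T = set0) ?cards0 ?subn0 //; apply/eqP; rewrite setI_eq0.
    by rewrite disjoint_sym; apply: disjointWl TP dP.
  have := cardsC (A :|: I :|: T); rewrite -/X cU nE l'E.
  by rewrite !mulnDr; move: (K * l'.+1); clear; lia.
(* The part of [P] left by the gadgets only enlarges [X]. The factor [a = 16] yields goodness with
   [4 * 16 = 64], the limit allowed in [good_matching]. *)
have densX U : admissible e q U -> #|nb e U| <= 16 * #|nb e U :&: X|.
  move=> aU; apply: leq_trans (dens2 U aU) _; rewrite leq_mul2l /=.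
  apply/subset_leq_card/subsetP => x; rewrite !inE !negb_or => /andP[/andP[-> xP] ->].
  by rewrite /= (contra (subsetP TP x)).
have l'l : l' <= l by rewrite /l' -subnDA leq_subr.
have ll' : l.+1 <= 2 * l'.+1.
  by move: l'E hl hh; move: (h * h.+1); clear; lia.
have [v [f2 [v_inj gv good_layers]]] :=
  random_layers_of_set R deg mix gq g_ge gc k_ge q_ge n_gt0 KE isT l'l ll' (isT : 16 <= 16) cX densX.
(* Ending with [I] makes each path from [a j] finish at some [i (rho j)]. The injection [rho] is not
   under control, and merging by switches does not need it to be. *)
pose Ws := [seq layer v f2 j | j <- enum 'I_l'.+1] ++ [:: I].
have [|W|F [sF pF lF F_inj covF]] :=
  @layer_paths V e K (fun W => good 64 W /\ #|W| = K) matching (fun W gW => proj2 gW) A Ws.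
- by split.
- rewrite mem_cat inE => /orP[/mapP[j _ ->]|/eqP-> //]; split; first exact: good_layers.
  exact: card_layer.
have aA j : a j \in A by rewrite AE imset_f.
pose outa j := take l'.+1 (F (a j)).
pose tau j := last (a j) (F (a j)).
pose rho j := odflt ord0 [pick j' | i j' == tau j].
have rhoE j : i (rho j) = tau j.
  have : tau j \in I by have := lF _ (aA j); rewrite /Ws last_cat.
  rewrite IE /rho => /imsetP[j' _ E]; case: pickP => [j'' /eqP //|/(_ j')].
  by rewrite E eqxx.
have FE j : F (a j) = rcons (outa j) (i (rho j)).
  rewrite rhoE /outa /tau; have := sF _ (aA j).
  rewrite /Ws size_cat size_map size_enum_ord /= addn1; case/lastP: (F (a j)) => // s z.
  by rewrite size_rcons last_rcons => -[sz]; rewrite -{2}cats1 take_size_cat.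
have rho_inj : injective rho.
  move=> j j' E; apply: a_inj; apply: F_inj => //; rewrite -/(tau j) -/(tau j').
  by rewrite -!rhoE E.
have outaP j : path e (a j) (rcons (outa j) (i (rho j))) by rewrite -FE pF.
have [S [cycS sizeS covS]] := assemble_cycle e_sym (fun j => proj1 (eij j))
  (fun j => proj2 (eij j)) (fun j => proj1 (zz j)) (fun j => proj2 (zz j)) rho_inj outaP outbP.
have szS : size S = n.
  rewrite sizeS (eq_bigr (fun j => (4 + h0 * (2 * h + 2) + l'.+1) + size (outb j))) => [|j _].
    rewrite big_split /= sum_nat_const card_ord soutb nE l'E.
    rewrite addnA -mulnDr; congr (_ * _ + _).
    by move: (l'.+1) h0; clear; lia.
  rewrite sBs /outa size_takel // (sF _ (aA j)) /Ws size_cat size_map size_enum_ord.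
  exact: leq_addr.
have allS x : x \in S.
  have [xX|xX] := boolP (x \in X).
    have : x \in grid v by rewrite gv.
    rewrite (layer_cover v f2) => /existsP[j xj].
    have [||y] := covF (layer v f2 j) x.
    - by rewrite /Ws mem_cat map_f ?mem_enum.
    - by [].
    rewrite AE => /imsetP[j' _ ->]; rewrite FE mem_rcons inE => /predU1P[->|xo].
      by apply: (covS (rho j')); rewrite inE eqxx.
    by apply: (covS j'); rewrite !mem_cat xo !orbT.
  move: xX; rewrite !inE negbK => /orP[/orP[|]|xT].
  - by rewrite AE => /imsetP[j _ ->]; apply: (covS j); rewrite !inE eqxx orbT.
  - by rewrite IE => /imsetP[j _ ->]; apply: (covS j); rewrite !inE eqxx.
  have [j] := covT x xT; rewrite !mem_cat !inE => xj; apply: (covS j).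
  by rewrite !mem_cat !inE; case/or3P: xj => [/orP[]|->|->]; rewrite ?orbT // => ->; rewrite !orbT.
exists S; split=> //; apply/card_uniqP; rewrite szS.
by apply: eq_card => x; rewrite allS.
Qed.

End Core.

(** * Choice of the parameters *)

(** With [w = 2 log n + 5] the choices are [k = w], so that [8 n ^ 2 <= 2 ^ k], then
    [l.+1 = x = B w ^ 2] and [q = 2048 x w]. Thus [2 g q <= B w x <= x ^ 2 <= d]. Further, [m] is
    about [n / 1024] and [h] its binary logarithm rounded up, so [128 h (h + 1) <= B w ^ 2]. *)
Lemma parameter_choice (n d B g : nat) :
  2 * g * (32 * 64) <= B -> 64 * 64 <= g -> (B * (2 * trunc_log 2 n + 5) ^ 2) ^ 2 <= d ->
  d <= n -> 4096 <= n ->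
  exists q l k k0 h0 m,
    [/\ 2 * g * q <= d, 8 * l.+1 * n <= 2 ^ k, 32 * 64 * l.+1 * k <= q &
        k0.+1 = n %/ l.+1] /\
    [/\ 64 <= k0.+1, 128 * (h0.+1 * h0.+2) <= l.+1, 0 < m & 1024 * m <= n] /\
    [/\ n <= 2048 * m, m <= 2 ^ h0.+1 & 2 ^ h0.+1 <= 2 * m].
Proof.
set t := trunc_log 2 n; set w := 2 * t + 5 => gB g_ge Bd dn n_ge.
have w_ge : 5 <= w by rewrite leq_addl.
have B_ge : 128 <= B.
  apply: leq_trans gB; apply: (@leq_trans (2 * 1 * (32 * 2))) => //.
  by rewrite leq_mul // leq_mul2l (leq_trans _ g_ge).
pose x := B * w ^ 2; rewrite -/x in Bd.
have x_ge : 128 <= x by rewrite (leq_trans B_ge) // leq_pmulr // expn_gt0 (leq_trans _ w_ge).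
have xn : x <= n.
  by apply: leq_trans dn; apply: leq_trans Bd; rewrite leq_pmulr // (leq_trans _ x_ge).
have x64 : 64 * x <= n.
  apply: leq_trans dn; apply: leq_trans Bd; rewrite leq_mul2r.
  by rewrite (leq_trans _ x_ge) ?orbT.
have lE : x.-1.+1 = x by rewrite prednK // (leq_trans _ x_ge).
have K64 : 64 <= n %/ x by rewrite leq_divRL // (leq_trans _ x_ge).
have KE : (n %/ x).-1.+1 = n %/ x by rewrite prednK // (leq_trans _ K64).
pose m := n %/ 1024; pose h := up_log 2 m.
have m_le : 1024 * m <= n by rewrite mulnC leq_divM.
have n_lt : n < 1024 * m + 1024 by rewrite {1}(divn_eq n 1024) mulnC ltn_add2l ltn_pmod.
have m_gt1 : 1 < m by rewrite leq_divRL //; apply: leq_trans n_ge.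
have h_gt0 : 0 < h by rewrite up_log_gt0 m_gt1.
have hE : h.-1.+1 = h by rewrite prednK.
have /andP[h1 h2] := up_log_bounds (isT : 1 < 2) m_gt1.
have ht : h <= t.+1.
  rewrite -hE ltnS; apply: trunc_log_max => //; rewrite (leq_trans (ltnW h1)) //.
  by rewrite leq_div.
exists (32 * 64 * x * w), x.-1, w, (n %/ x).-1, h.-1, m; rewrite lE KE hE.
split; [split=> //|split; split=> //].
- apply: leq_trans Bd; rewrite (_ : _ * _ = 2 * g * (32 * 64) * w * x).
    by rewrite leq_mul2r {2}/x (leq_mul gB) ?orbT // leq_pmulr // (leq_trans _ w_ge).
  by clearbody x w; clear; lia.
- apply: leq_trans (_ : 8 * n * n <= _); first by rewrite leq_mul2r leq_mul2l xn !orbT.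
  have n2 : n <= 2 ^ t.+1 by rewrite ltnW // trunc_log_ltn.
  apply: leq_trans (_ : 8 * (2 ^ t.+1 * 2 ^ t.+1) <= _).
    by rewrite -mulnA leq_mul2l leq_mul.
  by rewrite -expnD -(expnD 2 3) leq_exp2l // /w; clear; lia.
- apply: leq_trans (_ : 128 * (t.+1 * t.+2) <= _).
    by rewrite leq_mul2l leq_mul // ltnS.
  rewrite /x; apply: leq_mul => //; rewrite -mulnn leq_mul // /w; clear; lia.
- exact: ltnW.
- by clear -n_lt m_gt1; clearbody m; lia.
- rewrite -hE expnS leq_mul2l; exact: ltnW.
Qed.

Section Growth.
Local Open Scope ring_scope.
Variable R : realType.

(* A power of n beats every power of log n: [expR y >= y ^ 5 / 5!] with y = alpha ln n. *)
Lemma polylog_le_powR (alpha : R) (B : nat) : 0 < alpha ->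
  exists n0 : nat, forall n d : nat, (n0 <= n)%N -> (n%:R) `^ alpha <= d%:R ->
    ((B * (2 * trunc_log 2 n + 5) ^ 2) ^ 2 <= d)%N.
Proof.
move=> a0; pose y : R := alpha * ln 2.
have y0 : 0 < y by rewrite mulr_gt0 // ln_gt0 // ltr1n.
have yE : y = alpha * ln 2 by []; clearbody y.
(* Here [120 = 5!] and [2401 = 7 ^ 4], from [2 t + 5 <= 7 t]. Once [t >= X], the fifth power of [t]
   in the exponential series beats the fourth power to be bounded. *)
pose X : R := 120 * 2401 * B%:R ^+ 2 / y ^+ 5.
have X0 : 0 <= X.
  rewrite /X divr_ge0 //; last exact: exprn_ge0 (ltW y0).
  by rewrite mulr_ge0 // mulr_ge0.
pose t0 := (Num.bound X).+1; exists (2 ^ t0)%N => n d n_ge nd.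
have n_gt0 : (0 < n)%N by apply: leq_trans n_ge; rewrite expn_gt0.
set t := trunc_log 2 n.
have t_ge : (t0 <= t)%N by apply: trunc_log_max.
have tn : (2 ^ t <= n)%N by apply: trunc_logP.
have t1 : 1 <= t%:R :> R by rewrite ler1n (leq_trans _ t_ge).
have tX : X <= t%:R.
  apply: le_trans (_ : t0%:R <= _); last by rewrite ler_nat.
  by rewrite (le_trans (ltW (archi_boundP X0))) // ler_nat.
have nt : t%:R * ln 2 <= ln n%:R :> R.
  by rewrite mulr_natl -lnXn ?ltr0n // ler_ln ?posrE ?exprn_gt0 ?ltr0n // -natrX ler_nat.
have e5 : (t%:R * y) ^+ 5 / 120 <= d%:R.
  apply: le_trans nd; rewrite /powR pnatr_eq0 gtn_eqF //.
  apply: le_trans (_ : expR (t%:R * y) <= _).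
    apply: le_trans (expR_ge1Dxn 4 _); last by rewrite mulr_ge0 // ltW.
    by rewrite lerDr.
   by rewrite ler_expR yE mulrCA ler_wpM2l // ltW.
rewrite -(ler_nat R) (le_trans _ e5) // natrX natrM natrX natrD natrM.
have s7 : 2 * t%:R + 5 <= 7 * t%:R :> R by lra.
have s0 : 0 <= 2 * t%:R + 5 :> R by lra.
apply: le_trans (_ : (B%:R * (7 * t%:R) ^+ 2) ^+ 2 <= _).
  rewrite lerXn2r ?nnegrE ?mulr_ge0 ?exprn_ge0 ?ler0n // ?ler_wpM2l //.
  by rewrite lerXn2r ?nnegrE ?mulr_ge0.
have XE : 120 * 2401 * B%:R ^+ 2 = X * y ^+ 5 by rewrite /X divfK // gt_eqF // exprn_gt0.
rewrite ler_pdivlMr //.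
have -> : (B%:R * (7 * t%:R) ^+ 2) ^+ 2 * 120 = 120 * 2401 * B%:R ^+ 2 * t%:R ^+ 4 :> R by ring.
rewrite XE exprMn (exprS t%:R 4) mulrAC ler_wpM2r ?exprn_ge0 //.
by rewrite ler_wpM2r ?exprn_ge0 ?(ltW y0).
Qed.
End Growth.

Local Open Scope ring_scope.

Theorem theorem1p3 (R : realType) (alpha : R) (halpha : 0 < alpha) :
  exists C : R, 0 < C /\
    forall (n : nat) (e : rel 'I_n) (d : nat) (lam : R),
      @ndl_graph R n e d lam ->
      (n%:R) `^ alpha <= d%:R ->
      0 < lam ->
      C <= d%:R / lam ->
      hamiltonian e.
Proof.
pose g := (64 * 64)%N; pose B := (2 * g * (32 * 64))%N.
have [n0 n0P] := polylog_le_powR B halpha.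
(* The summand [4 * g] serves all mixing estimates; the summand [n0] ensures [n >= n0], because
   [c < n]. *)
pose c := (n0 + 4 * g)%N.
have gc : (4 * g <= c)%N by rewrite leq_addl.
have c_gt1 : (1 < c)%N by apply: leq_trans gc.
exists c%:R; split; first by rewrite ltr0n ltnW.
move=> n e d lam G nd lam0 clam.
(* The characteristic polynomial has degree [n] and the linear factor of [d]. *)
have n_gt0 : (0 < n)%N.
  rewrite lt0n; apply/eqP => n_eq0; move: G => [_ _ [s [chA _]]]; move: chA.
  move=> /(congr1 (fun p : {poly R} => size p)); rewrite size_char_poly.
  have := size_prod_XsubC (d%:R :: s) id; rewrite big_cons /= => -> /eqP.
  by rewrite n_eq0.
have cn := ndl_card_gt G lam0 n_gt0 clam.
have [[e_sym _] _ _] := G.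
have dn : (d <= n)%N.
  by rewrite -(ndl_deg G (Ordinal n_gt0)) (leq_trans (max_card _)) ?card_ord.
have n_ge : (4096 <= n)%N.
  by apply: leq_trans (ltnW cn); apply: leq_trans gc; apply: (@leq_pmull g 4).
have := parameter_choice (leqnn _ : 2 * g * (32 * 64) <= B)%N (leqnn g) (n0P n d _ nd) dn n_ge.
case=> [|q [l [k [k0 [h0 [m [[gq k_ge q_ge KE] [[K_ge hl m_gt0 m_le] [m_ge mh hm]]]]]]]]].
  by rewrite (leq_trans (leq_addr _ _) (ltnW cn)).
have := @hamilton_cycle R 'I_n e d c g q l k k0 h0 m e_sym (ndl_deg G)
  (ndl_mixing G c_gt1 lam0 clam) gq (leqnn _) gc; rewrite card_ord.
case/(_ k_ge q_ge n_gt0 KE K_ge hl m_gt0 m_le m_ge mh hm) => S [uS sS cS].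
exists S; split=> //; rewrite sS; exact: leq_trans n_ge.
Qed.
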